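(* Let $G$ be an $n$-vertex, $K_{r+1}$-free graph where $r\ge 3$. (a) If $G$ is not traceable and $n \ge 20$ if $r=3$, $n\ge 1$ if $r \ge 4$, then $e(G) \leq e(T_r(n-1))$. Equality holds if and only if $G$ is $T_r(n-1)$ plus an isolated vertex, i.e., $G \in \mathcal{G}^{-1}_{n,r}$, or $G$ is $K_{3,1}$, $K_{4,1,1}$, or $K_{5,1,1,1}$, with the exceptional graphs occurring in the cases where $r \ge 4$ and $n=4$, or $(r,n)$ is $(4,6)$ or $(4,8)$, respectively. (b) If $G$ is not Hamiltonian and $n\ge 26$ if $r=3$, $n \ge 11$ if $r=4$, $n\ge 2$ if $r \ge 5$, then $e(G) \leq e(T_r(n-1)) + 1$. Equality holds if and only if $G \in \mathcal{G}^{0}_{n,r}$ or $G$ is $K_{3,1,1}$, $K_{6,2,2,1}$, $K_{4,1,1,1}$, or $K_{5,1,1,1,1}$, with the exceptional graphs occurring in the cases where $r \ge 5$ and $n =5$, or $(r,n)$ is $(4,11)$, $(5,7)$, or $(5,9)$, respectively. (c) If $G$ is not Hamiltonian-connected and $n \ge 32$ if $r=3$, $n\ge 16$ if $r=4$, $n\ge 10$ if $r=5$, $n\ge 4$ if $r \ge 6$, then $e(G) \leq e(T_r(n-1)) + 2$. Equality holds if and only if $G \in \mathcal{G}^{1}_{n,r}$ or $G$ is $K_{3,1,1,1}$, $K_{4,1,1,1,1}$, $K_{5,2,1,1,1}$, or $K_{5,1,1,1,1,1}$, with the exceptional graphs occurring in the cases where $r \ge 6$ and $n=6$, or $(r,n)$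 is $(6,8)$, $(5,10)$ or $(6,10)$, respectively. (d) For every $k \ge 0$, if $G$ is not $k$-Hamiltonian and $n \ge 6k+26$ if $r=3$, $n\ge 5k+11$ if $4 \le r \le 7$, $n\ge k+5+4(k+4)/(r-4)$ if $r \ge 8$, then $e(G) \leq e(T_r(n-1)) + (k+1)$. Equality holds if and only if $G \in \mathcal{G}^{k}_{n,r}$ or $G \in \widehat{\mathcal{H}}^{k}_{n,r}$. (e) For every $k \ge 1$, if $G$ is not $k$-Hamiltonian-connected and $n \ge 6k+26$ if $r=3$, $n\ge 5k+11$ if $r=4$, $n\ge 3k+7$ if $5 \le r \le 7$, $n\ge k+5+4(k+4)/(r-4)$ if $r \ge 8$, then $e(G) \leq e(T_r(n-1)) + (k+1)$. Equality holds if and only if $G \in \mathcal{G}^{k}_{n,r}$ or $G \in \widehat{\mathcal{H}}^{k}_{n,r}$. (f) For every $k \ge 1$, if $G$ is not $k$-connected and $n \ge 6k+14$ if $r=3$, $n\ge 5k+1$ if $4 \le r \le 7$, $n\ge 2k+5$ if $r \ge 8$, then $e(G) \leq e(T_r(n-1)) + (k-1)$. Equality holds if and only if $G \in \mathcal{G}^{k-2}_{n,r}$. In all cases $\mathcal{G}^{\ell}_{n,r}$ is nonempty (with $\ell=-1,0,1,k,k,k-2$ in parts (a)–(f), respectively), and the bounds are tight.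
   Context: Graphs are simple. $e(G)$ is the number of edges of $G$. $T_r(n)$ is the Turán graph: the $n$-vertex complete $r$-partite graph with parts as balanced as possible (so $T_r(n)=K_n$ if $n\le r$). $K_{a_1,\dots,a_p}$ is the complete multipartite graph with parts of sizes $a_1,\dots,a_p$. A graph is traceable if it has a Hamiltonian path, Hamiltonian if it has a Hamiltonian cycle, and Hamiltonian-connected if every pair of vertices is connected by a Hamiltonian path. An $n$-vertex graph $G$ is: $k$-Hamiltonian ($0\le k\le n-3$) if $G-S$ is Hamiltonian for each set $S$ of at most $k$ vertices; $k$-Hamiltonian-connected ($1\le k\le n-2$) if $G-S$ is Hamiltonian-connected for each set $S$ of fewer than $k$ vertices; $k$-connected ($1\le k\le n-1$) if $G-S$ is connected for each set $S$ of fewer than $k$ vertices. $\mathcal{G}^{\ell}_{n,r}$ is the set of $n$-vertex, $K_{r+1}$-free graphs consisting of $T_r(n-1)$ plus one additional vertex of degree $\ell+1$. $\widehat{\mathcal{H}}^{\ell}_{n,r}$ is the set of graphs $G$ such that $(G,r,n)$ appears in the following list for the given $\ell$ (it is empty for $(\ell,r,n)$ not occurring): $\ell=-1$: $(K_{4,1,1},4,6)$, $(K_{5,1,1,1},4,8)$; $\ell=0$: $(K_{6,2,2,1},4,11)$, $(K_{4,1,1,1},5,7)$, $(K_{5,1,1,1,1},5,9)$; $\ell=1$: $(K_{4,1,1,1,1},6,8)$, $(K_{5,2,1,1,1},5,10)$, $(K_{5,1,1,1,1,1},6,10)$; $\ell=2$: $(K_{6,2,2,2,1},5,13)$, $(K_{5,2,1,1,1,1},6,11)$,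 $(K_{5,1,1,1,1,1,1},7,11)$, $(K_{4,1,1,1,1,1},7,9)$; $\ell=3$: $(K_{5,2,1,1,1,1,1},7,12)$; $\ell=4$: $(K_{6,2,2,2,2,1},6,15)$, $(K_{5,2,2,1,1,1,1},7,13)$; $\ell=6$: $(K_{6,2,2,2,2,2,1},7,17)$. *)

(* Defs.v *)
From mathcomp Require Import all_boot all_order all_algebra.

Set Implicit Arguments.
Unset Strict Implicit.
Unset Printing Implicit Defensive.

Record sgraph := SGraph {
  svertex :> finType;
  sedge : rel svertex;
  sedge_sym : symmetric sedge;
  sedge_irrefl : irreflexive sedge }.

Arguments sedge {s} x y.

Notation "x -- y" := (sedge x y) (at level 30).

Section GraphNotions.

Variable G : sgraph.

Definition edge_set : {set {set G}} :=
  [set [set p.1; p.2] | p : G * G & p.1 -- p.2].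

Definition num_edges : nat := #|edge_set|.

Definition degree (v : G) : nat := #|[set w | v -- w]|.

(* K_m-freeness: no m vertices are pairwise adjacent. *)
Definition clique_free (m : nat) : Prop :=
  forall A : {set G}, {in A &, forall x y, x != y -> x -- y} -> #|A| <> m.

Definition connected : Prop := forall x y : G, connect (@sedge G) x y.

Definition ham_path (x : G) (p : seq G) : Prop :=
  [/\ path sedge x p, uniq (x :: p) & forall z, z \in x :: p].

Definition traceable : Prop := exists x p, ham_path x p.

(* [cycle] also accepts the closed walk x, y, x along a single edge, so the
   length of a cycle has to be required to be at least 3. *)
Definition hamiltonian : Prop :=
  exists c : seq G,
    [/\ cycle sedge c, uniq c, 2 < size c & forall z, z \in c].

Definition ham_connected : Prop :=
  forall x y : G, x != y -> exists p, ham_path x p /\ last x p = y.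

End GraphNotions.

Arguments clique_free : clear implicits.

Section DelVertices.

Variables (G : sgraph) (S : {set G}).

Definition del_rel : rel {x : G | x \notin S} := fun x y => val x -- val y.

Lemma del_rel_sym : symmetric del_rel.
Proof. by move=> x y; apply: sedge_sym. Qed.

Lemma del_rel_irrefl : irreflexive del_rel.
Proof. by move=> x; apply: sedge_irrefl. Qed.

Definition del_vertices : sgraph := SGraph del_rel_sym del_rel_irrefl.

End DelVertices.

(* The three notions below are used only for k <= n - 3, 1 <= k <= n - 2 and
   1 <= k <= n - 1 respectively, where n is the number of vertices. *)
Definition k_hamiltonian (k : nat) (G : sgraph) : Prop :=
  forall S : {set G}, #|S| <= k -> hamiltonian (del_vertices S).

Definition k_ham_connected (k : nat) (G : sgraph) : Prop :=
  forall S : {set G}, #|S| < k -> ham_connected (del_vertices S).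

Definition k_connected (k : nat) (G : sgraph) : Prop :=
  forall S : {set G}, #|S| < k -> connected (del_vertices S).

Definition isomorphic (G H : sgraph) : Prop :=
  exists2 f : G -> H, bijective f & forall x y, f x -- f y = x -- y.

Section Turan.

Variables r n : nat.

Definition turan_rel : rel 'I_n := fun i j => i %% r != j %% r.

Lemma turan_rel_sym : symmetric turan_rel.
Proof. by move=> i j; rewrite /turan_rel eq_sym. Qed.

Lemma turan_rel_irrefl : irreflexive turan_rel.
Proof. by move=> i; rewrite /turan_rel eqxx. Qed.

(* T_r(n) on {0, ..., n - 1}; the parts are the residue classes modulo r, whose
   sizes differ by at most one. *)
Definition turan : sgraph := SGraph turan_rel_sym turan_rel_irrefl.

End Turan.

Section CompleteMultipartite.

Variable a : seq nat.

Definition multipartite_vertex := {i : 'I_(size a) & 'I_(nth 0 a i)}.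

Definition multipartite_rel : rel multipartite_vertex :=
  fun x y => tag x != tag y.

Lemma multipartite_rel_sym : symmetric multipartite_rel.
Proof. by move=> x y; rewrite /multipartite_rel eq_sym. Qed.

Lemma multipartite_rel_irrefl : irreflexive multipartite_rel.
Proof. by move=> x; rewrite /multipartite_rel eqxx. Qed.

Definition complete_multipartite : sgraph :=
  SGraph multipartite_rel_sym multipartite_rel_irrefl.

End CompleteMultipartite.

Definition calG (l : int) (n r : nat) (G : sgraph) : Prop :=
  [/\ #|G| = n, clique_free G r.+1 &
      exists v : G, [/\ isomorphic (del_vertices [set v]) (turan r n.-1)
                      & ((degree v)%:Z = l + 1)%R]].

(* An entry (l, a, r, n) means that K_a belongs to the family with
   parameters l, n, r. *)
Definition exceptional : seq (int * seq nat * nat * nat) :=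
  [:: ((-1)%Z, [:: 4; 1; 1], 4, 6);
      ((-1)%Z, [:: 5; 1; 1; 1], 4, 8);
      (0%Z, [:: 6; 2; 2; 1], 4, 11);
      (0%Z, [:: 4; 1; 1; 1], 5, 7);
      (0%Z, [:: 5; 1; 1; 1; 1], 5, 9);
      (1%Z, [:: 4; 1; 1; 1; 1], 6, 8);
      (1%Z, [:: 5; 2; 1; 1; 1], 5, 10);
      (1%Z, [:: 5; 1; 1; 1; 1; 1], 6, 10);
      (2%Z, [:: 6; 2; 2; 2; 1], 5, 13);
      (2%Z, [:: 5; 2; 1; 1; 1; 1], 6, 11);
      (2%Z, [:: 5; 1; 1; 1; 1; 1; 1], 7, 11);
      (2%Z, [:: 4; 1; 1; 1; 1; 1], 7, 9);
      (3%Z, [:: 5; 2; 1; 1; 1; 1; 1], 7, 12);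
      (4%Z, [:: 6; 2; 2; 2; 2; 1], 6, 15);
      (4%Z, [:: 5; 2; 2; 1; 1; 1; 1], 7, 13);
      (6%Z, [:: 6; 2; 2; 2; 2; 2; 1], 7, 17)].

Definition calHhat (l : int) (n r : nat) (G : sgraph) : Prop :=
  exists a : seq nat,
    (l, a, r, n) \in exceptional /\ isomorphic G (complete_multipartite a).

(* Main.v *)
From Stdlib Require Import Classical_Prop.
Require Import Defs.
From mathcomp Require Import all_boot all_order all_algebra zify ring lra.

Set Implicit Arguments.
Unset Strict Implicit.
Unset Printing Implicit Defensive.

(** The theorem is proved in one parameter L = l + 1, which is 0, 1, 2, k + 1,
    k + 1, k - 1 in the six parts; the claimed bound is e(T_r(n-1)) + L.

    Suppose first that G lacks one of the Hamiltonian properties. The degree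
    sequence theorem of Chvatal, proved here from Ore's closure argument for all
    the properties at once, gives an index i with 2i + L <= n such that i
    vertices have degree at most D = i + L - 1 and n - D vertices have degree at
    most n - i - 1 ([chvatal_degrees]); for the properties with a parameter k one
    applies it after the deletion of a set of vertices ([witness_del]). If i = 1,
    there is a vertex of degree at most L, and the theorem of Turan for the rest
    of the graph, with its uniqueness part, gives the bound and the family calG
    ([small_degree_bound], [small_degree_eq]).

    For i >= 2 the idea is to use the theorem of Turan in the form
    e(H) <= y(h - y) + e(T_{r-1}(y)), where H has h vertices and maximum degree y
    ([max_degree_turan_bound]); the right-hand side is the size of an independent
    set joined to a Turan graph. Vertices of degree at most D are deleted until
    the maximum degree is D. Each deleted vertex costs at most D edges, exactly
    what a vertex of the independent set of the join costs, so in total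
    e(G) <= D(n - D) + e(T_{r-1}(D)) ([low_degree_bound]). If the maximum degree
    stays above D even after all i vertices are deleted, then either the bound
    just stated still holds, or e(G) <= iD + e(T_r(n - i)), which is less than
    e(T_r(n-1)) + L because the sizes of Turan graphs grow quickly
    ([many_low_degrees]).

    The bound D(n - D) + e(T_{r-1}(D)) increases with i, so everything depends on
    its value for the largest i. The thresholds on n are what makes this value at
    most e(T_r(n-1)) + L; equality holds only for n = 2i + L and a short list of
    parameters ([exceptional_or_gap]), and then G is the complete multipartite
    graph whose parts are n - D and those of T_{r-1}(D) ([low_degree_eq]). These
    are the exceptional graphs.

    If G is not k-connected, the same scheme is simpler: the smaller side X of
    a separation by fewer than k vertices is either a single vertex of degree
    at most L, or has so few edges to the outside that the bound is strict
    ([disconnected_extremal]).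

    The bounds are attained by T_r(n-1) with one more vertex of degree L
    ([exists_calG], [calG_extremal]). *)

(** * Sizes of Turan graphs *)

(** The number of edges of T_r(n), counted by adding the vertices 0, 1, ... in
    turn: vertex m has m / r earlier vertices in its own residue class modulo
    r. *)
Fixpoint turan_size (r n : nat) : nat :=
  if n is m.+1 then turan_size r m + (m - m %/ r) else 0.

(** Here q and q.+1 are the sizes of the parts of T_r(n). Both bounds on n are
    non-strict because at a multiple of r the formulas for two consecutive
    values of q agree; the induction on n uses this overlap. *)
Lemma turan_size_exact r n q : r * q <= n <= r * q.+1 ->
  2 * turan_size r n + (2 * q + 1) * n = n ^ 2 + r * q * q.+1.
Proof.
elim: n q => [|n IH] q.
  by rewrite leqn0 muln_eq0 => /andP[/orP[]/eqP-> _]; rewrite !(mul0n, muln0).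
case/andP=> lo hi; rewrite [turan_size r n.+1]/=.
have [loq|] := leqP (r * q) n.
  have r_gt0 : 0 < r by case: (r) hi.
  have -> : n %/ r = q.
    by apply/eqP; rewrite eqn_leq -ltnS ltn_divLR // leq_divRL //; apply/andP; split; lia.
  have := IH q; rewrite loq /= (leq_trans (leqnSn n) hi) => /(_ isT).
  have : q <= n by nia.
  nia.
move=> nlt; have e : n.+1 = r * q by lia.
have r_gt0 : 0 < r by case: (r) e.
case: q e lo hi nlt => [|q] e lo hi nlt; first by lia.
have -> : n %/ r = q.
  by apply/eqP; rewrite eqn_leq -ltnS ltn_divLR // leq_divRL //; apply/andP; split; lia.
have := IH q; have -> : r * q <= n <= r * q.+1 by apply/andP; split; nia.
move=> /(_ isT); have : q <= n by nia.
nia.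
Qed.

Lemma turan_size_div r n : 0 < r ->
  2 * turan_size r n + (2 * (n %/ r) + 1) * n = n ^ 2 + r * (n %/ r) * (n %/ r).+1.
Proof.
move=> r_gt0; apply: turan_size_exact; rewrite mulnC leq_divM /=.
by rewrite mulnC ltnW // ltn_ceil.
Qed.

(** The function n ^ 2 - 2 * turan_size r n is convex and piecewise linear in
    n, and the exact formula for a fixed q is one of its supporting lines, so
    that a wrong q can only overestimate the size. All later estimates replace
    quotients by such lines. *)
Lemma turan_size_tangent r n q : 0 < r ->
  2 * turan_size r n + (2 * q + 1) * n <= n ^ 2 + r * q * q.+1.
Proof.
move=> r_gt0; have := turan_size_div n r_gt0.
have := divn_eq n r; have := ltn_pmod n r_gt0.
move: (n %/ r) (n %% r) => p s ltsr e.
suff: r * p * p.+1 + (2 * q + 1) * n <= r * q * q.+1 + (2 * p + 1) * n by nia.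
have [/subnKC<-|/ltnW /subnKC ep] := leqP p q.
  move: (q - p) => d; have : d * (2 * s) <= d * (r * d.+1).
    by case: d => [//|d]; rewrite leq_mul2l orFb; nia.
  nia.
rewrite e -ep; move: (p - q) => d.
have : r * d <= r * (d * d) by rewrite leq_mul2l; case: d => [|d]; rewrite ?orbT // leq_pmulr ?orbT.
nia.
Qed.

(** Joining an independent set of a = n - y vertices to T_r(y) gives a
    K_{r+2}-free graph, so this is a case of the theorem of Turan, but it is
    needed to prove that theorem. With q the part size of T_{r+1}(n), twice the
    difference of the two sides is at least (a - q) * (a - q - 1), which is
    nonnegative for integers. *)
Lemma turan_size_join r n y : 0 < r -> y <= n ->
  y * (n - y) + turan_size r y <= turan_size r.+1 n.
Proof.
move=> r_gt0 le_yn; have := turan_size_div n (ltn0Sn r).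
move: (n %/ r.+1) => q; have := turan_size_tangent y q r_gt0.
rewrite -[in n ^ 2](subnKC le_yn) -[in (_ * n)](subnKC le_yn); move: (n - y) => a.
have : (2 * q + 1) * a <= a ^ 2 + q * q.+1.
  by have [] := leqP a q => [/subnKC<-|/subnKC<-]; [move: (q - a)|move: (a - q.+1)] => d; nia.
nia.
Qed.

(** At integers, x ^ 2 lies above its chord between q and q.+1, and touches it
    only at these two points. *)
Lemma sq_tangent (q x : nat) : (2 * q + 1) * x <= x ^ 2 + q * q.+1.
Proof.
by have [] := leqP x q => [/subnKC<-|/subnKC<-];
  [move: (q - x)|move: (x - q.+1)] => d; nia.
Qed.

Lemma sq_tangent_eq (q x : nat) : x ^ 2 + q * q.+1 <= (2 * q + 1) * x ->
  (x == q) || (x == q.+1).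
Proof.
have [] := leqP x q => [/subnKC<-|/subnKC<-].
  move: (q - x) => [|d] le; first by rewrite addn0 eqxx.
  by exfalso; nia.
move: (x - q.+1) => [|d] le; first by rewrite addn0 eqxx orbT.
by exfalso; nia.
Qed.

Definition sumsq (s : seq nat) := sumn [seq x ^ 2 | x <- s].

Lemma sumsq_tangent q s :
  (2 * q + 1) * sumn s <= sumsq s + size s * (q * q.+1).
Proof.
elim: s => [|x s IH]; first by rewrite muln0.
rewrite /sumsq /= -/(sumsq s); have := sq_tangent q x; lia.
Qed.

Lemma sumsq_tangent_eq q s :
  sumsq s + size s * (q * q.+1) <= (2 * q + 1) * sumn s ->
  all (pred2 q q.+1) s.
Proof.
elim: s => [//|x s IH]; rewrite /sumsq /= -/(sumsq s) => le.
have := sq_tangent q x; have := sumsq_tangent q s => le1 le2.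
by rewrite sq_tangent_eq ?IH //=; lia.
Qed.

(** The multiset of part sizes of T_r(n), empty parts included. *)
Definition turan_parts (r n : nat) : seq nat :=
  nseq (r - n %% r) (n %/ r) ++ nseq (n %% r) (n %/ r).+1.

(** A complete r-partite graph with parts s has (n ^ 2 - sumsq s) / 2 edges. If
    this reaches the size of T_r(n), then the chord inequality with q = n / r,
    summed over the parts, is an equality, so every part has size q or q.+1. *)
Lemma balanced_parts r s : 0 < r -> size s = r ->
  sumsq s + 2 * turan_size r (sumn s) <= sumn s ^ 2 ->
  perm_eq s (turan_parts r (sumn s)).
Proof.
move=> r_gt0 szs le; rewrite /turan_parts.
have dq := turan_size_div (sumn s) r_gt0; have dv := divn_eq (sumn s) r.
have ltm := ltn_pmod (sumn s) r_gt0.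
move: (sumn s %/ r) (sumn s %% r) dq dv ltm => q m dq dv ltm.
have als : all (pred2 q q.+1) s by apply: sumsq_tangent_eq; rewrite szs; lia.
have [pm sm] : perm_eq s (nseq (count_mem q s) q ++ nseq (count_mem q.+1 s) q.+1)
    /\ sumn s = size s * q + count_mem q.+1 s /\ count_mem q s + count_mem q.+1 s = size s.
  elim: s als {szs le dq dv} => [//|x s IH] /= /andP[/orP[]/eqP-> /IH [pm [e1 e2]]].
    rewrite eqxx eqn_leq ltnn andbF add1n add0n /= perm_cons; split=> //.
    by rewrite mulSn; move: e1 e2; move: (count _ s) (count _ s) => u v; lia.
  have -> : (q.+1 == q) = false by lia.
  rewrite eqxx add1n add0n; split; last first.
    by rewrite mulSn; move: e1 e2; move: (count _ s) (count _ s) => u v; lia.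
  by rewrite perm_sym (perm_catCA _ [:: q.+1] _) perm_cons perm_sym.
have em : count_mem q.+1 s = m by rewrite szs in sm; nia.
by rewrite -em -[r in r - _]szs -sm.2 addnK.
Qed.

(** * Degree sums and the theorem of Turan *)

Lemma subset_of_card (T : finType) (A : {set T}) k : k <= #|A| ->
  exists2 S : {set T}, S \subset A & #|S| = k.
Proof.
case/card_geqP => s [us ss sA]; exists [set x in s].
  by apply/subsetP => x; rewrite inE => /sA.
by rewrite cardsE (card_uniqP us).
Qed.

Section Degrees.
Variable G : sgraph.
Implicit Types (A B K : {set G}) (x y : G).

Definition degree_in A x := #|[set y in A | x -- y]|.
Definition degree_sum A := \sum_(x in A) degree_in A x.
Definition is_clique K := {in K &, forall x y, x != y -> x -- y}.
(** A version of [clique_free] relative to a vertex set, so that the inductions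
    below stay inside one graph. *)
Definition clique_bounded A r := forall K, K \subset A -> is_clique K -> #|K| <= r.
(** The subgraph induced on A is complete multipartite, its parts being the
    classes of c; some of the r classes may be empty. *)
Definition multipartite_on A r (c : G -> nat) :=
  {in A, forall x, c x < r} /\ {in A &, forall x y, x -- y = (c x != c y)}.

Lemma degree_inE A x : degree_in A x = \sum_(y in A) (x -- y).
Proof.
by rewrite /degree_in -sum1_card big_mkcond [RHS]big_mkcond; apply: eq_bigr => y _;
   rewrite inE; case: (y \in A) => //=; case: (x -- y).
Qed.

Lemma degree_inT x : degree_in setT x = degree x.
Proof. by apply: eq_card => y; rewrite !inE. Qed.

Lemma degree_in_sub A B x : A \subset B -> degree_in A x <= degree_in B x.
Proof.
move=> sAB; apply: subset_leq_card; apply/subsetP => y; rewrite !inE.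
by case/andP=> /(subsetP sAB) -> ->.
Qed.

Lemma degree_in_split A B x : B \subset A ->
  degree_in A x = degree_in B x + degree_in (A :\: B) x.
Proof.
move=> sBA; rewrite !degree_inE (big_setID B) /=.
by rewrite (setIidPr sBA).
Qed.

Lemma degree_in_le A x : degree_in A x <= #|A|.
Proof. by apply: subset_leq_card; apply/subsetP => y; rewrite inE => /andP[]. Qed.

Lemma degree_in_lt A x : x \in A -> degree_in A x < #|A|.
Proof.
move=> xA; rewrite [#|A|](cardsD1 x) xA add1n ltnS.
apply: subset_leq_card; apply/subsetP => y; rewrite !inE => /andP[-> xy].
by rewrite andbT; apply: contraTneq xy => ->; rewrite sedge_irrefl.
Qed.

Lemma degree_sum_double A B :
  \sum_(x in A) degree_in B x = \sum_(x in B) degree_in A x.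
Proof.
under eq_bigr do rewrite degree_inE.
rewrite exchange_big /=; apply: eq_bigr => y _; rewrite degree_inE.
by apply: eq_bigr => x _; rewrite sedge_sym.
Qed.

(** An inclusion-exclusion: twice the number of edges inside A is twice the
    number inside the complement of B plus twice the number meeting B, and the
    degrees of the vertices of B count the edges inside B twice. *)
Lemma degree_sum_split A B : B \subset A ->
  degree_sum A + degree_sum B = degree_sum (A :\: B) + 2 * \sum_(x in B) degree_in A x.
Proof.
move=> sBA; rewrite /degree_sum (big_setID B) /= (setIidPr sBA).
have -> : \sum_(x in A :\: B) degree_in A x =
   \sum_(x in A :\: B) degree_in B x + \sum_(x in A :\: B) degree_in (A :\: B) x.
  by rewrite -big_split; apply: eq_bigr => x _; rewrite /= (degree_in_split _ sBA).
rewrite (degree_sum_double (A :\: B) B).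
have -> : \sum_(x in B) degree_in A x =
   \sum_(x in B) degree_in B x + \sum_(x in B) degree_in (A :\: B) x.
  by rewrite -big_split; apply: eq_bigr => x _; rewrite /= (degree_in_split _ sBA).
lia.
Qed.

Lemma clique_bounded_sub A B r : A \subset B -> clique_bounded B r -> clique_bounded A r.
Proof. by move=> sAB cb K sKA; apply: cb; apply: subset_trans sAB. Qed.

Lemma clique_bounded_nbr A r x : x \in A -> clique_bounded A r.+1 ->
  clique_bounded [set y in A | x -- y] r.
Proof.
move=> xA cb K sK cK.
have xK : x \notin K.
  by apply: contraL (subxx K) => xK; move: (subsetP sK x xK); rewrite inE sedge_irrefl andbF.
have := cb (x |: K); rewrite cardsU1 xK add1n ltnS; apply.
  apply/subsetP => y; rewrite !inE => /orP[/eqP-> //|/(subsetP sK)].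
  by rewrite inE => /andP[].
have adj y : y \in K -> x -- y by move/(subsetP sK); rewrite inE => /andP[].
move=> y z; rewrite !inE => /orP[/eqP->|yK] /orP[/eqP->|zK] ne; rewrite ?eqxx // in ne *.
- exact: adj.
- by rewrite sedge_sym adj.
- exact: cK.
Qed.

Lemma clique_bounded1 A x y : clique_bounded A 1 -> x \in A -> y \in A -> ~ x -- y.
Proof.
move=> cb xA yA xy; have nxy : x != y by apply: contraTneq xy => ->; rewrite sedge_irrefl.
suff: #|[set x; y]| <= 1 by rewrite cards2 nxy.
apply: cb; first by apply/subsetP => z; rewrite !inE => /orP[]/eqP->.
move=> u v; rewrite !inE => /orP[]/eqP-> /orP[]/eqP->; rewrite ?eqxx //.
by rewrite sedge_sym.
Qed.

Lemma clique_freeP r : clique_free G r.+1 -> clique_bounded setT r.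
Proof.
move=> cf K _ cK; rewrite leqNgt; apply/negP => ltrK.
have [S sSK cS] := subset_of_card ltrK.
by apply: (cf S _ cS) => x y /(subsetP sSK) xK /(subsetP sSK); apply: cK.
Qed.

Lemma max_degree_in A : A != set0 ->
  exists2 w, w \in A & {in A, forall x, degree_in A x <= degree_in A w}.
Proof.
case/set0Pn=> x0 x0A; case: (arg_maxnP (degree_in A) x0A) => w wA mx.
by exists w => // x xA; apply: mx.
Qed.

(** The step of the proof by Erdos: N is the neighbourhood of a vertex of
    maximum degree y, and every edge not inside N meets A :\: N, whose vertices
    number #|A| - y and have degree at most y. Edges inside A :\: N are counted
    twice, which is why degree_sum (A :\: N) appears on the left. *)
Lemma degree_sum_step A w (y : nat) : w \in A -> degree_in A w = y ->
  {in A, forall x, degree_in A x <= y} ->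
  let N := [set x in A | w -- x] in
  degree_sum A + degree_sum (A :\: N) <= degree_sum N + 2 * (y * (#|A| - y))
  ?= iff [forall x in A :\: N, degree_in A x == y].
Proof.
move=> wA yE le N; have sNA : N \subset A by apply/subsetP => x; rewrite inE => /andP[].
have cN : #|N| = y by rewrite -yE.
rewrite degree_sum_split ?subsetDl // setDDr setDv set0U (setIidPr sNA).
have cD : #|A :\: N| = #|A| - y by rewrite cardsD (setIidPr sNA) cN.
have -> : y * (#|A| - y) = \sum_(x in A :\: N) y by rewrite sum_nat_const cD mulnC.
have := @leqif_sum _ (fun x => x \in A :\: N) (fun x => degree_in A x == y)
   (fun x => degree_in A x) (fun=> y).
case=> [x|le1 eq1].
  by rewrite inE => /andP[_ xA]; split=> //; apply: le.
split; first by rewrite leq_add2l leq_mul2l.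
by rewrite -eq1 eqn_add2l eqn_mul2l.
Qed.

(** Stated for an arbitrary bound on K_{r+1}-free sets because it is the
    inductive step of the theorem of Turan. *)
Lemma max_degree_bound A r w (y : nat) : 0 < r ->
  (forall B, clique_bounded B r -> degree_sum B <= 2 * turan_size r #|B|) ->
  clique_bounded A r.+1 -> w \in A -> degree_in A w = y ->
  {in A, forall x, degree_in A x <= y} ->
  degree_sum A <= 2 * (y * (#|A| - y) + turan_size r y).
Proof.
move=> r_gt0 IH cb wA yE le; have [+ _] := degree_sum_step wA yE le.
have := IH _ (clique_bounded_nbr wA cb); rewrite [#|_|]yE; lia.
Qed.

End Degrees.

(** By induction on r: the neighbourhood of a vertex of maximum degree y is
    K_r-free, and the bound obtained is that of an independent set joined to a
    Turan graph on y vertices. *)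
Theorem turan_bound r (G : sgraph) (A : {set G}) : 0 < r -> clique_bounded A r ->
  degree_sum A <= 2 * turan_size r #|A|.
Proof.
case: r => // r _; elim: r A => [|r IH] A cb.
  rewrite [degree_sum A]big1 // => x xA; apply/eqP; rewrite cards_eq0.
  apply/eqP/setP => y; rewrite !inE; apply/negP => /andP[yA xy].
  exact: clique_bounded1 cb xA yA xy.
have [->|nA] := eqVneq A set0; first by rewrite /degree_sum big_set0.
have [w wA le] := max_degree_in nA.
have := max_degree_bound (ltn0Sn r) IH cb wA erefl le.
have := @turan_size_join r.+1 #|A| (degree_in A w) isT (degree_in_le _ _).
lia.
Qed.

Section Multipartite.
Variable G : sgraph.
Implicit Types (A B K : {set G}) (x y : G).

(** Keeping the maximum degree y in the bound, instead of optimizing over y, is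
    what makes vertices of small degree useful later. *)
Lemma max_degree_turan_bound A r w (y : nat) : 0 < r ->
  clique_bounded A r.+1 -> w \in A -> degree_in A w = y ->
  {in A, forall x, degree_in A x <= y} ->
  degree_sum A <= 2 * (y * (#|A| - y) + turan_size r y).
Proof.
by move=> r_gt0; apply: max_degree_bound => // B; apply: turan_bound.
Qed.

(** In the equality case the vertices outside N are pairwise nonadjacent and
    all have degree y = #|N|, hence are adjacent to exactly the vertices of N. *)
Lemma max_degree_turan_eq A r w (y : nat) : 0 < r ->
  clique_bounded A r.+1 -> w \in A -> degree_in A w = y ->
  {in A, forall x, degree_in A x <= y} ->
  2 * (y * (#|A| - y) + turan_size r y) <= degree_sum A ->
  let N := [set x in A | w -- x] in
  [/\ degree_sum N = 2 * turan_size r y &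
      {in A :\: N, forall x z, z \in A -> x -- z = (z \in N)}].
Proof.
move=> r_gt0 cb wA yE le ge N.
have [le1 eq1] := degree_sum_step wA yE le.
have le2 := turan_bound r_gt0 (clique_bounded_nbr wA cb); rewrite [#|_|]yE in le2.
rewrite -/N in le1 eq1 le2.
have e0 : degree_sum (A :\: N) = 0 by lia.
have eN : degree_sum N = 2 * turan_size r y by lia.
have /forall_inP eD : [forall x in A :\: N, degree_in A x == y].
  by rewrite -eq1; apply/eqP; lia.
split=> // x xD z zA.
have sNA : N \subset A by apply/subsetP => u; rewrite inE => /andP[].
have e1 : degree_in (A :\: N) x = 0.
  by apply/eqP; move/eqP: e0; rewrite /degree_sum sum_nat_eq0 => /forall_inP; apply.
have eNx : [set u in N | x -- u] = N.
  apply/eqP; rewrite eqEcard; apply/andP; split.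
    by apply/subsetP => u; rewrite inE => /andP[].
  have := eD x xD; rewrite (degree_in_split _ sNA) e1 addn0 => /eqP e.
  by rewrite [leqRHS]e -yE.
have [zN|zN] := boolP (z \in N).
  by move: zN; rewrite -{1}eNx inE => /andP[].
by move/eqP: e1; rewrite cards_eq0 => /eqP/setP/(_ z); rewrite inE in_setD zN zA in_set0.
Qed.

Lemma multipartite_extend A (N : {set G}) r c : N \subset A -> multipartite_on N r c ->
  {in A :\: N, forall x z, z \in A -> x -- z = (z \in N)} ->
  multipartite_on A r.+1 (fun x => if x \in N then c x else r).
Proof.
move=> sNA [cr cE] h; split=> [x xA|x y xA yA].
  by case: ifP => // /cr /ltnW.
case: (boolP (x \in N)) => xN; case: (boolP (y \in N)) => yN.
- exact: cE.
- by rewrite sedge_sym h // ?inE ?yN // xN ltn_eqF // cr.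
- by rewrite h // ?inE ?xN // yN gtn_eqF // cr.
- by rewrite h // ?inE ?xN // eqxx (negPf yN).
Qed.

Lemma degree_in_multipartite A r c x : multipartite_on A r c -> x \in A ->
  degree_in A x + #|[set y in A | c y == c x]| = #|A|.
Proof.
case=> cr cE xA; rewrite -(cardsID [set y | x -- y] A); congr (_ + _).
  by apply: eq_card => y; rewrite !inE.
apply: eq_card => y; rewrite !inE; case: (boolP (y \in A)) => yA; last by rewrite andbF.
by rewrite andbT cE // eq_sym negbK.
Qed.

Definition part_sizes A r (c : G -> nat) : seq nat :=
  [seq #|[set x in A | c x == j]| | j <- iota 0 r].

(** With F the constant 1 this counts A, and with F the identity it sums the
    squares of the parts. *)
Lemma sum_part_sizes A r c (F : nat -> nat) : {in A, forall x, c x < r} ->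
  \sum_(x in A) F #|[set y in A | c y == c x]| =
  sumn [seq k * F k | k <- part_sizes A r c].
Proof.
move=> cr; have -> : sumn [seq k * F k | k <- part_sizes A r c] =
    \sum_(0 <= j < r) #|[set x in A | c x == j]| * F #|[set x in A | c x == j]|.
  by rewrite sumnE !big_map /index_iota subn0.
rewrite big_mkord.
pose cc x : 'I_r.+1 := inord (c x).
case: r cr @cc => [|r] cr cc.
  by rewrite big_ord0 big1 // => x /cr.
rewrite (partition_big (fun x => inord (c x) : 'I_r.+1) xpredT) //=.
apply: eq_bigr => j _; rewrite -sum_nat_const big_mkcond [RHS]big_mkcond /=.
apply: eq_bigr => x _; rewrite inE; case: (boolP (x \in A)) => //= xA.
have -> : (inord (c x) == j) = (c x == j).
  by rewrite -val_eqE /= inordK // cr.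
by case: eqP => // ->.
Qed.

Lemma sumn_part_sizes A r c : {in A, forall x, c x < r} ->
  sumn (part_sizes A r c) = #|A|.
Proof.
move=> cr; have := sum_part_sizes (fun=> 1) cr.
by rewrite sum1_card => ->; congr sumn; rewrite -[LHS]map_id; apply: eq_map => k; rewrite muln1.
Qed.

Lemma degree_sum_multipartite A r c : multipartite_on A r c ->
  degree_sum A + sumsq (part_sizes A r c) = #|A| ^ 2.
Proof.
move=> mA; have [cr _] := mA; rewrite /sumsq -(sum_part_sizes id cr).
rewrite -big_split /= (eq_bigr (fun=> #|A|)) ?sum_nat_const -?expnS //.
by move=> x xA; apply: degree_in_multipartite mA xA.
Qed.

Lemma part_sizes_turan A r c : 0 < r -> multipartite_on A r c ->
  2 * turan_size r #|A| <= degree_sum A ->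
  perm_eq (part_sizes A r c) (turan_parts r #|A|).
Proof.
move=> r_gt0 mA le; have [cr _] := mA.
rewrite -(sumn_part_sizes cr); apply: balanced_parts => //.
  by rewrite size_map size_iota.
by have := degree_sum_multipartite mA; rewrite (sumn_part_sizes cr); lia.
Qed.

End Multipartite.

(** Only the complete multipartite structure is asserted here; the part sizes
    then follow from the number of edges. *)
Theorem turan_unique r (G : sgraph) (A : {set G}) : 0 < r -> clique_bounded A r ->
  2 * turan_size r #|A| <= degree_sum A -> exists c, multipartite_on A r c.
Proof.
case: r => // r _; elim: r A => [|r IH] A cb ge.
  exists (fun=> 0); split=> // x y xA yA; rewrite eqxx; apply/negP => xy.
  exact: clique_bounded1 cb xA yA xy.
have [A0|nA] := eqVneq A set0; first by exists (fun=> 0); split=> [x|x y]; rewrite A0 inE.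
have [w wA le] := max_degree_in nA.
have [|eN h] := max_degree_turan_eq (ltn0Sn r) cb wA erefl le.
  have := @turan_size_join r.+1 #|A| (degree_in A w) isT (degree_in_le _ _).
  lia.
set N := [set _ in _ | _] in eN h.
have [||c mc] := IH N; first exact: clique_bounded_nbr.
  by rewrite eN.
exists (fun x => if x \in N then c x else r.+1).
by apply: multipartite_extend mc h; apply/subsetP => x; rewrite inE => /andP[].
Qed.

(** * Isomorphism of complete multipartite graphs *)

(** Every edge is the image of exactly two ordered pairs of adjacent vertices. *)
Lemma handshake (G : sgraph) : 2 * num_edges G = degree_sum [set: G].
Proof.
pose P := [set p : G * G | p.1 -- p.2].
pose f (p : G * G) := [set p.1; p.2].
have -> : degree_sum [set: G] = #|P|.
  rewrite -sum1_card (eq_bigl (fun p : G * G => xpredT p.1 && (p.1 -- p.2))); last first.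
    by move=> p; rewrite inE.
  rewrite -(pair_big_dep xpredT (fun x y : G => x -- y) (fun _ _ => 1)) /=.
  rewrite /degree_sum; apply: eq_big => [x|x _]; first by rewrite inE.
  by rewrite degree_inT /degree -sum1_card; apply: eq_bigl => y; rewrite inE.
rewrite /num_edges.
have -> : edge_set G = f @: P.
  by apply/setP => E; apply/imsetP/imsetP => -[p p_e ->]; exists p; rewrite // inE in p_e *.
rewrite -[RHS]sum1_card (partition_big_imset f) /= mulnC -sum_nat_const.
apply: eq_bigr => E /imsetP[[x y] + ->]; rewrite inE /= => xy.
have nxy : x != y by apply: contraTneq xy => ->; rewrite sedge_irrefl.
have <- : #|[set (x, y); (y, x)]| = 2 by rewrite cards2 xpair_eqE negb_and nxy.
rewrite sum1_card; apply: eq_card => -[u v]; rewrite /P /f !inE !xpair_eqE /=.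
apply/orP/andP => [[]/andP[/eqP-> /eqP->]|[]]; rewrite inE /=.
- by rewrite xy eqxx.
- by rewrite sedge_sym xy setUC eqxx.
move=> uv /eqP/setP e.
have nuv : u != v by apply: contraTneq uv => ->; rewrite sedge_irrefl.
have := e u; have := e v; rewrite !inE !eqxx orbT /=.
do 2!move=> /esym/orP[]/eqP ?; subst; rewrite ?eqxx in nuv *; by [|left|right].
Qed.

Lemma iso_num_edges (G H : sgraph) : isomorphic G H -> num_edges G = num_edges H.
Proof.
case=> f bij_f fE; apply/eqP; rewrite -(eqn_pmul2l (isT : 0 < 2)) !handshake; apply/eqP.
rewrite /degree_sum (reindex f) /=; last exact: onW_bij.
apply: eq_big => [x|x _]; rewrite ?inE // !degree_inT /degree.
rewrite -(card_imset _ (bij_inj bij_f)); apply: eq_card => y.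
have [g gK fK] := bij_f.
by rewrite -[y]fK (mem_imset _ _ (bij_inj bij_f)) inE [RHS]inE fE.
Qed.

Lemma card_sub_set (G : sgraph) (S : {set G}) : #|del_vertices S| = #|~: S|.
Proof. by rewrite card_sig; apply: eq_card => x; rewrite !inE. Qed.

Lemma degree_in_del (G : sgraph) (S : {set G}) (x : del_vertices S) (A : {set G}) :
  A \subset ~: S ->
  degree_in [set y : del_vertices S | val y \in A] x = degree_in A (val x).
Proof.
move=> sA; rewrite /degree_in -(card_imset _ val_inj); apply: eq_card => y.
apply/imsetP/idP => [[z + ->]|]; first by rewrite !inE.
rewrite inE => /andP[yA xy]; have yS : y \notin S by move/subsetP: sA => /(_ y yA); rewrite inE.
by exists (exist _ y yS) => //; rewrite !inE /= yA.
Qed.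

(** Degrees of a subgraph obtained by deletion are degrees into a vertex set of
    the original graph, so that all counting can be done in the latter. *)
Lemma degree_del (G : sgraph) (S : {set G}) (x : del_vertices S) :
  degree x = degree_in (~: S) (val x).
Proof.
rewrite -degree_in_del // -degree_inT; congr degree_in.
by apply/setP => y; rewrite !inE (valP y).
Qed.

Lemma sum_sub_set (G : sgraph) (S : {set G}) (F : G -> nat) :
  \sum_(x : del_vertices S) F (val x) = \sum_(x in ~: S) F x.
Proof.
rewrite (eq_bigl (fun x => x \in [set val y | y : del_vertices S])).
  by rewrite big_imset //= => x y _ _; apply: val_inj.
move=> x; rewrite inE; apply/idP/imsetP => [xS|[y _ ->]]; last by case: y.
by exists (exist _ x xS).
Qed.

Lemma num_edges_del (G : sgraph) (S : {set G}) :
  2 * num_edges (del_vertices S) = degree_sum (~: S).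
Proof.
rewrite handshake /degree_sum -sum_sub_set.
by apply: eq_big => [x|x _]; rewrite ?inE // degree_inT degree_del.
Qed.

Lemma num_edges_del1 (G : sgraph) (v : G) :
  num_edges G = num_edges (del_vertices [set v]) + degree v.
Proof.
apply/eqP; rewrite -(eqn_pmul2l (isT : 0 < 2)) mulnDr handshake num_edges_del.
have := @degree_sum_split G setT [set v] (subsetT _).
rewrite big_set1 setTD {2}/degree_sum big_set1 degree_inT => <-.
rewrite [degree_in [set v] v](_ : _ = 0) ?addn0 //.
apply/eqP; rewrite cards_eq0; apply/eqP/setP => y; rewrite !inE.
by case: eqP => [->|//]; rewrite sedge_irrefl.
Qed.

(** A vertex is sent to the vertex with the same position in the enumeration of
    the class of the same colour. *)
Lemma iso_of_equal_parts (G H : sgraph) r c d :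
  multipartite_on [set: G] r c -> multipartite_on [set: H] r d ->
  (forall j, j < r -> #|[set x | c x == j]| = #|[set x | d x == j]|) ->
  isomorphic G H.
Proof.
move=> [cr cE] [dr dE] e.
have cGH : #|G| = #|H|.
  rewrite -!cardsT -(sumn_part_sizes cr) -(sumn_part_sizes dr); congr sumn.
  apply/eq_in_map => j; rewrite mem_iota => /andP[_ ltj].
  have eT (K : sgraph) (a : K -> nat) : #|[set x in [set: K] | a x == j]| = #|[set x | a x == j]|.
    by apply: eq_card => x; rewrite !inE.
  by rewrite !eT e.
have yH (x : G) : H.
  have : 0 < #|H| by rewrite -cGH; apply/card_gt0P; exists x.
  by case/card_gt0P/sigW.
pose f x := nth (yH x) (enum [set y | d y == c x]) (index x (enum [set y | c y == c x])).
have idx x : index x (enum [set y | c y == c x]) < size (enum [set y | d y == c x]).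
  by rewrite -cardE -e ?cr // cardE index_mem mem_enum inE.
have df x : d (f x) = c x.
  have : f x \in enum [set y | d y == c x] by rewrite mem_nth.
  by rewrite mem_enum inE => /eqP.
have inj_f : injective f.
  move=> x y exy; have ec : c x = c y by rewrite -!df exy.
  move: exy; have := idx x; have := idx y; rewrite /f ec => i1 i2.
  rewrite (set_nth_default (yH x)) // => /eqP; rewrite (nth_uniq _ i2 i1) ?enum_uniq //.
  have xs : x \in enum [set z | c z == c y] by rewrite mem_enum inE ec.
  have ys : y \in enum [set z | c z == c y] by rewrite mem_enum inE.
  by move/eqP; apply: index_inj xs ys.
exists f; first by apply: inj_card_bij => //; rewrite cGH.
by move=> x y; rewrite dE ?cE ?inE // !df.
Qed.

(** A permutation matching the part sizes is used to rename the colours of G. *)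
Lemma iso_of_parts (G H : sgraph) r c d :
  multipartite_on [set: G] r c -> multipartite_on [set: H] r d ->
  perm_eq (part_sizes [set: G] r c) (part_sizes [set: H] r d) ->
  isomorphic G H.
Proof.
move=> mG mH /(perm_iotaP 0)[Is pIs eIs].
have szIs : size Is = r by rewrite (perm_size pIs) size_iota size_map size_iota.
have uIs : uniq Is by rewrite (perm_uniq pIs) iota_uniq.
have mIs j : (j \in Is) = (j < r).
  by rewrite (perm_mem pIs) mem_iota size_map size_iota.
have [cr cE] := mG.
apply: (@iso_of_equal_parts _ _ r (fun x => nth 0 Is (c x)) d) => // [|j ltj].
  split=> [x _|x y xT yT]; first by rewrite -mIs mem_nth // szIs cr.
  by rewrite cE // nth_uniq // szIs cr.
have jIs : j \in Is by rewrite mIs.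
have ltix : index j Is < r by rewrite -szIs index_mem.
have := congr1 (fun s => nth 0 s (index j Is)) eIs.
rewrite (nth_map 0) ?size_iota // nth_iota // add0n (nth_map 0) ?index_mem // nth_index //.
rewrite (nth_map 0) ?size_iota // nth_iota // add0n.
have eT (K : sgraph) (a : pred K) : #|[set x in [set: K] | a x]| = #|[set x | a x]|.
  by apply: eq_card => x; rewrite !inE.
rewrite !eT => <-; apply: eq_card => x; rewrite !inE.
by rewrite -{1}(nth_index 0 jIs) nth_uniq // ?szIs // cr.
Qed.

Lemma turan_multipartite r n : 0 < r ->
  multipartite_on [set: turan r n] r (fun i : turan r n => (i : 'I_n) %% r).
Proof. by move=> r_gt0; split=> [x _|x y _ _] //; rewrite ltn_pmod. Qed.

(** The right-hand side increases by one from n to n.+1 exactly when n has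
    residue j. *)
Lemma count_residue r n j : j < r -> \sum_(i < n) (i %% r == j) = (n + (r - j.+1)) %/ r.
Proof.
move=> ltj; have r_gt0 : 0 < r by apply: leq_trans ltj.
elim: n => [|n IH]; first by rewrite big_ord0 divn_small //; lia.
rewrite big_ord_recr /= IH addSn divnS // addnC; congr (nat_of_bool _ + _).
have -> : (n + (r - j.+1)).+1 = n %/ r * r + (n %% r + (r - j)).
  by rewrite {1}(divn_eq n r); lia.
rewrite dvdn_addr ?dvdn_mull //; have := ltn_pmod n r_gt0; move: (n %% r) => m ltm.
apply/eqP/idP => [->|/dvdnP[[|[|k]] e]]; [|lia|lia|nia].
by rewrite subnKC // ltnW.
Qed.

Lemma turan_num_edges r n : 0 < r -> num_edges (turan r n) = turan_size r n.
Proof.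
move=> r_gt0; apply/eqP; rewrite -(eqn_pmul2l (isT : 0 < 2)) handshake.
have eD m : degree_sum [set: turan r m] = \sum_(i < m) \sum_(j < m) (i %% r != j %% r).
  rewrite /degree_sum; apply: eq_big => [i|i _]; rewrite ?inE // degree_inE.
  by apply: eq_bigl => j; rewrite inE.
rewrite eD; elim: n => [|n IH]; first by rewrite big_ord0.
rewrite big_ord_recr /= [X in _ + X]big_ord_recr /= eqxx addn0.
under eq_bigr do rewrite big_ord_recr /=.
rewrite big_split /= (eqP IH).
have e1 : \sum_(i < n) (n %% r != i %% r) + n %/ r = n.
  have <- : (n + (r - (n %% r).+1)) %/ r = n %/ r.
    have ltm := ltn_pmod n r_gt0; rewrite {1}(divn_eq n r).
    by rewrite -addnA divnMDl // [X in _ + X]divn_small ?addn0 //; move: (n %% r) ltm => m ltm; lia.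
  rewrite -(count_residue n (ltn_pmod n r_gt0)) -[RHS]card_ord -[RHS]sum1_card -big_split /=.
  by apply: eq_bigr => i _; rewrite eq_sym; case: eqP.
have -> : \sum_(i < n) (i %% r != n %% r) = \sum_(i < n) (n %% r != i %% r).
  by apply: eq_bigr => i _; rewrite eq_sym.
by apply/eqP; move: e1; move: (\sum_(i < n) _) => s; lia.
Qed.

(** The part sizes are not computed: having the maximal number of edges already
    forces them to be balanced. *)
Lemma turan_part_sizes r n : 0 < r ->
  perm_eq (part_sizes [set: turan r n] r (fun i : turan r n => (i : 'I_n) %% r))
    (turan_parts r n).
Proof.
move=> r_gt0; have := part_sizes_turan r_gt0 (turan_multipartite n r_gt0).
by rewrite cardsT card_ord -handshake turan_num_edges //; apply.
Qed.

Lemma iso_turan r (G : sgraph) : 0 < r -> clique_bounded [set: G] r ->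
  turan_size r #|G| <= num_edges G -> isomorphic G (turan r #|G|).
Proof.
move=> r_gt0 cb ge.
have ge2 : 2 * turan_size r #|[set: G]| <= degree_sum [set: G].
  by rewrite cardsT -handshake leq_mul2l.
have [c mc] := turan_unique r_gt0 cb ge2.
apply: (iso_of_parts mc (turan_multipartite _ r_gt0)).
have := part_sizes_turan r_gt0 mc ge2; rewrite cardsT => pe.
apply: perm_trans pe _; rewrite perm_sym; exact: turan_part_sizes.
Qed.

Lemma complete_multipartite_colouring a r : size a <= r ->
  multipartite_on [set: complete_multipartite a] r (fun x : multipartite_vertex a => tag x).
Proof.
move=> le; split=> [x _|x y _ _] //; exact: leq_trans (ltn_ord _) le.
Qed.

Lemma complete_multipartite_parts a r : size a <= r ->
  part_sizes [set: complete_multipartite a] r (fun x : multipartite_vertex a => tag x)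
  = a ++ nseq (r - size a) 0.
Proof.
move=> le; apply: (@eq_from_nth _ 0).
  by rewrite size_map size_iota size_cat size_nseq subnKC.
move=> j; rewrite size_map size_iota => ltj.
rewrite (nth_map 0) ?size_iota // nth_iota // add0n nth_cat nth_nseq if_same.
case: ifP => [lta|/negbT]; last first.
  rewrite -leqNgt => lea; apply/eqP; rewrite cards_eq0; apply/eqP/setP => x.
  by rewrite !inE; apply/negP => /eqP e; have := ltn_ord (tag x); rewrite e ltnNge lea.
pose jj := Ordinal lta.
have injT : injective (fun y : 'I_(nth 0 a jj) => Tagged (fun i : 'I_(size a) => 'I_(nth 0 a i)) y).
  by move=> y z e; exact: (@eq_from_Tagged _ (fun i : 'I_(size a) => 'I_(nth 0 a i)) _ _ _ e).
rewrite -[RHS]card_ord -[RHS]cardsT -(card_imset _ injT); apply: eq_card => -[i y].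
rewrite !inE /=; apply/idP/idP => [/eqP ei|]; last first.
  by case/imsetP => z _ e; have /= -> := congr1 tag e.
have eij : i = jj by apply: val_inj.
by move: y; rewrite eij => y; rewrite imset_f ?inE.
Qed.

Lemma complete_multipartite_num_edges a :
  2 * num_edges (complete_multipartite a) + sumsq a = sumn a ^ 2.
Proof.
have mc := complete_multipartite_colouring (leqnn (size a)).
have := degree_sum_multipartite mc; have [cr _] := mc.
by rewrite -(sumn_part_sizes cr) complete_multipartite_parts // subnn cats0 handshake.
Qed.

Lemma iso_complete_multipartite (G : sgraph) r c a : size a <= r ->
  multipartite_on [set: G] r c ->
  perm_eq (part_sizes [set: G] r c) (a ++ nseq (r - size a) 0) ->
  isomorphic G (complete_multipartite a).
Proof.
move=> le mc pe; apply: (iso_of_parts mc (complete_multipartite_colouring le)).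
by rewrite complete_multipartite_parts.
Qed.

(** * Degree sequences without Hamiltonian cycles *)

Section HamCycle.
Variable T : finType.
Implicit Types (e : rel T) (u v x : T).

Definition rel_degree e x := #|[set y | e x y]|.
Definition ham_cycle e := exists c : seq T, [/\ cycle e c, uniq c & forall z, z \in c].
Definition add_edge e u v : rel T :=
  fun x y => [|| e x y, (x == u) && (y == v) | (x == v) && (y == u)].

Lemma add_edge_sym e u v : symmetric e -> symmetric (add_edge e u v).
Proof. by move=> es x y; rewrite /add_edge es; do !case: eqP => //=; rewrite ?orbT. Qed.

Lemma add_edge_irrefl e u v : u != v -> irreflexive e -> irreflexive (add_edge e u v).
Proof.
by move=> nuv ei x; rewrite /add_edge ei /=; case: eqP => [->|_]; case: eqP => //= euv;
   rewrite euv eqxx in nuv.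
Qed.

Lemma add_edgeC e u v : add_edge e u v =2 add_edge e v u.
Proof. by move=> x y; rewrite /add_edge [X in _ || X]orbC. Qed.

(** Without a crossing, the predecessors on the path of the neighbours of v are
    nonneighbours of u. *)
Lemma crossing_count e u v x p :
  (forall p1 b p2, p = p1 ++ b :: p2 -> ~~ (e u (last x p1) && e v b)) ->
  count (e u) (belast x p) + count (e v) p <= size p.
Proof.
elim: p x => [//|a p IH] x h /=.
have := h [::] a p erefl; rewrite /= => h0.
have := IH a (fun p1 b p2 ep => h (a :: p1) b p2 (congr1 (cons a) ep)).
have : e u x + e v a <= 1 by case: (e u x) (e v a) h0 => [] [].
by lia.
Qed.

Lemma rel_degree_count e u s : uniq s -> (forall z, z \in s) ->
  rel_degree e u = count (e u) s.
Proof.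
move=> us fs; rewrite /rel_degree cardE -size_filter; apply: perm_size.
apply: uniq_perm; rewrite ?enum_uniq ?filter_uniq // => y.
by rewrite mem_enum inE mem_filter fs andbT.
Qed.

(** By counting, there are consecutive vertices a, b on the path with u
    adjacent to a and v adjacent to b; the path is cut between a and b, and its
    second half is reversed. *)
Lemma ham_path_closes e u v p : symmetric e -> irreflexive e ->
  path e v p -> uniq (v :: p) -> (forall z, z \in v :: p) -> last v p = u ->
  #|T| <= rel_degree e u + rel_degree e v -> ham_cycle e.
Proof.
move=> es ei pe up fp lp le.
have szp : #|T| = (size p).+1.
  by have /= <- := card_uniqP up; apply: eq_card => z; rewrite fp.
(* Position k stands for the edge of the path from its k-th to its next vertex. *)
pose crossing (k : 'I_(size p)) := e u (last v (take k p)) && e v (nth v p k).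
have [k /andP[eu ev]] : exists k, crossing k.
  apply/existsP; apply: contraLR le; rewrite negb_exists => /forallP h.
  rewrite -ltnNge szp ltnS (rel_degree_count _ _ up fp) (rel_degree_count _ v up fp).
  have -> : count (e u) (v :: p) = count (e u) (belast v p).
    by rewrite lastI lp -cats1 count_cat /= ei !addn0.
  rewrite /= ei add0n.
  apply: crossing_count => p1 b p2 ep.
  have ltp : size p1 < size p by rewrite ep size_cat /= -addSnnS leq_addr.
  have := h (Ordinal ltp); rewrite /crossing /= {2}ep nth_cat ltnn subnn /=.
  by rewrite ep take_size_cat.
have ep : p = take k p ++ nth v p k :: drop k.+1 p.
  by rewrite -drop_nth ?cat_take_drop.
move: ep eu ev; move: (take k p) (nth v p k) (drop k.+1 p) => p1 b p2 ep eu ev.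
rewrite {k crossing}ep in pe up fp lp szp.
rewrite last_cat /= in lp.
exists (v :: p1 ++ rev (b :: p2)); split.
- rewrite /cycle rcons_path; move: pe; rewrite !cat_path /= => /and3P[p1e _ p2e].
  have lr : last u (rev (belast b p2)) = b.
    by rewrite -[LHS]/(last b (_ :: _)) -lp -rev_rcons -lastI rev_cons last_rcons.
  have -> : rev (b :: p2) = u :: rev (belast b p2) by rewrite lastI lp rev_rcons.
  rewrite p1e last_cat /= es eu lr [e b v]es ev -lp rev_path /= andbT.
  by apply: sub_path p2e => x y; rewrite es.
- rewrite -cat_cons cat_uniq rev_uniq; move: up; rewrite -cat_cons cat_uniq.
  by case/and3P=> -> h ->; rewrite andbT /=; apply: contra h; rewrite (eq_has_r (mem_rev _)).
- by move=> z; have := fp z; rewrite -!cat_cons !mem_cat mem_rev.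
Qed.

(** A Hamiltonian cycle that uses the edge uv leaves, when this edge is
    removed, a Hamiltonian path from v to u. *)
Lemma ore_closure e u v : symmetric e -> irreflexive e -> ~~ e u v -> u != v ->
  #|T| <= rel_degree e u + rel_degree e v -> ham_cycle (add_edge e u v) -> ham_cycle e.
Proof.
move=> es ei nuv neuv le [c [cc uc fc]].
have [ce|/allPn[x xc nex]] := boolP (all (fun x => e x (next c x)) c).
  by exists c; split=> //; apply: cycle_from_next => // x /(allP ce).
have := next_cycle cc xc; rewrite /add_edge (negPf nex) /=.
wlog /andP[/eqP exu /eqP nexv] : u v nuv neuv le cc / (x == u) && (next c x == v).
  move=> wl /orP[h|h]; first by apply: (wl u v); rewrite ?h.
  apply: (wl v u); rewrite ?h //; first by rewrite es.
  - by rewrite eq_sym.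
  - by rewrite addnC.
  by rewrite (eq_cycle (add_edgeC _ _ _)).
move=> _; have vc : v \in c by apply: fc.
have [i p ec] := rot_to vc.
have up : uniq (v :: p) by rewrite -ec rot_uniq.
have fp z : z \in v :: p by rewrite -ec mem_rot.
have lp : last v p = u.
  apply: (can_inj (prev_next up)); rewrite -[in RHS]ec next_rot // -exu nexv.
  by rewrite next_nth mem_last index_last // nth_default.
apply: (ham_path_closes es ei _ up fp lp le).
have cp : path (add_edge e u v) v p.
  by have := cc; rewrite -(rot_cycle i) ec /= rcons_path => /andP[].
have/andP[vp _] := up.
have [p' ep] : exists p', p = rcons p' u.
  case/lastP: (p) lp => [/= evu|p' z]; first by rewrite evu eqxx in neuv.
  by rewrite last_rcons => ->; exists p'.
(* If the path is just v, u, the graph has two vertices and no edge. *)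
case: p' ep => [|a p'] ep.
  move: le; rewrite (rel_degree_count _ _ up fp) (rel_degree_count _ v up fp) ep /=.
  rewrite !ei [e v u]es (negPf nuv) leqn0 => /eqP/card0_eq/(_ v).
  by rewrite inE.
move: cp up vp; rewrite ep /= => /andP[e1 cp] /and3P[vp ap _] _; apply/andP; split.
  move: e1; rewrite /add_edge; case/or3P=> // /andP[/eqP h1 /eqP h2].
    by rewrite h1 eqxx in neuv.
  by rewrite h2 mem_rcons mem_head in ap.
apply: (sub_in_path (P := fun z => z != v)) cp => [s t|].
  move=> sv tv; rewrite /add_edge => /or3P[]// /andP[/eqP h1 /eqP h2].
    by rewrite h2 /in_mem /= eqxx in tv.
  by rewrite h1 /in_mem /= eqxx in sv.
by apply/allP => z zp; apply: contraNneq vp => <-.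
Qed.

Lemma rel_degree_sub e e' x : subrel e e' -> rel_degree e x <= rel_degree e' x.
Proof. by move=> s; apply: subset_leq_card; apply/subsetP => y; rewrite !inE => /s. Qed.

(** For L = 1 this is the classical condition on the degree sequence of a
    non-Hamiltonian graph: i vertices of degree at most i and n - i of degree
    below n - i, with i < n / 2. The case i = 1 is replaced by the existence of
    one vertex of degree at most L, a form that also makes sense for graphs
    with fewer than L + 2 vertices. *)
Definition chvatal_witness L e :=
  (exists v, rel_degree e v <= L) \/
  exists i (A M : {set T}), [/\ 2 <= i, 2 * i + L <= #|T|,
    i <= #|A| /\ {in A, forall x, rel_degree e x < i + L} &
    #|T| < #|M| + i + L /\ {in M, forall x, rel_degree e x + i < #|T|}].

(** Adding edges uv with large degree sum as long as possible, without ever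
    reaching P; the number of nonadjacent pairs decreases. *)
Lemma saturate (P : rel T -> Prop) L e : symmetric e -> irreflexive e ->
  (forall e u v, symmetric e -> irreflexive e -> ~~ e u v -> u != v ->
     #|T| + L <= (rel_degree e u + rel_degree e v).+1 -> P (add_edge e u v) -> P e) ->
  ~ P e -> exists e', [/\ symmetric e', irreflexive e', subrel e e', ~ P e' &
     forall u v, ~~ e' u v -> u != v -> (rel_degree e' u + rel_degree e' v).+1 < #|T| + L].
Proof.
move=> + + clo; have [m] := ubnP #|[set p | ~~ e p.1 p.2]|.
elim: m e => // m IH e lem es ei nP.
have [/existsP[u /existsP[v /and3P[nuv neuv le]]]|no] := boolP [exists u, exists v,
    [&& ~~ e u v, u != v & #|T| + L <= (rel_degree e u + rel_degree e v).+1]].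
  have [||||e' [es' ei' se' nP' h]] := IH (add_edge e u v).
  - rewrite -ltnS; apply: leq_trans lem; rewrite ltnS; apply: proper_card; apply/properP; split.
      by apply/subsetP => p; rewrite !inE; apply: contra => epp; rewrite /add_edge epp.
    by exists (u, v); rewrite !inE //= /add_edge !eqxx orbT.
  - exact: add_edge_sym.
  - exact: add_edge_irrefl.
  - by move=> Pe; apply: nP; apply: clo le Pe.
  by exists e'; split=> // x y exy; apply: se'; rewrite /add_edge exy.
exists e; split=> // u v nuv neuv; rewrite ltnNge; apply: contra no => le.
by apply/existsP; exists u; apply/existsP; exists v; rewrite nuv neuv.
Qed.

(** In a saturated graph, let u and v be nonadjacent with maximal degree sum
    and d(u) <= d(v). The nonneighbours of v then have degree at most d(u),
    those of u have degree at most d(v), and d(u) + d(v) is at most n + L - 2.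
    So i = d(u) + 1 - L works. The property P is abstract because it is used
    for cycles, paths and paths with prescribed ends. *)
Theorem chvatal_degrees (P : rel T -> Prop) L e : symmetric e -> irreflexive e ->
  (forall e, (forall x y, x != y -> e x y) -> irreflexive e -> P e) ->
  (forall e u v, symmetric e -> irreflexive e -> ~~ e u v -> u != v ->
     #|T| + L <= (rel_degree e u + rel_degree e v).+1 -> P (add_edge e u v) -> P e) ->
  ~ P e -> chvatal_witness L e.
Proof.
move=> es ei full clo /(saturate es ei clo)[e' [es' ei' se nP sat]].
have [p0 p0P] : exists p : T * T, ~~ e' p.1 p.2 && (p.1 != p.2).
  apply/existsP; apply: contraT; rewrite negb_exists => /forallP h; exfalso.
  apply: nP; apply: full => // x y nxy; have := h (x, y).
  by rewrite negb_and negbK /= (negPf nxy) orbF.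
pose D x := rel_degree e' x.
have [uv] := @arg_maxnP _ p0 (fun p => ~~ e' p.1 p.2 && (p.1 != p.2)) (fun p => D p.1 + D p.2) p0P.
wlog le_uv : uv / D uv.1 <= D uv.2.
  move=> wl; case/orP: (leq_total (D uv.1) (D uv.2)) => h; first exact: wl h.
  case: uv wl h => u v wl h /andP[nuv neuv] mx; apply: (wl (v, u)) => //=.
    by rewrite es' nuv eq_sym.
  by move=> q qP; have := mx q qP; rewrite /= [D v + _]addnC.
case: uv le_uv => u v /= le_uv /andP[nuv neuv] mx.
have {}sat := sat u v nuv neuv; rewrite -/(D u) -/(D v) in sat.
have [small|big] := leqP (D u) L.
  by left; exists u; apply: leq_trans (rel_degree_sub u se) small.
right; exists ((D u).+1 - L), [set w | ~~ e' v w & w != v], [set w | ~~ e' u w].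
have cM w : #|[set x | ~~ e' w x]| + D w = #|T|.
  rewrite addnC -(cardsC [set x | e' w x]); congr (_ + _).
  by apply: eq_card => x; rewrite !inE.
have cA : #|[set w | ~~ e' v w & w != v]|.+1 = #|[set x | ~~ e' v x]|.
  rewrite [RHS](cardsD1 v) inE ei' add1n; congr _.+1.
  by apply: eq_card => x; rewrite !inE andbC.
have := cM u; have := cM v; rewrite -cA => cMv cMu.
split; [by lia|by lia|split; first by lia|split; first by lia].
  move=> w; rewrite inE => /andP[nvw nwv]; apply: leq_ltn_trans (rel_degree_sub w se) _.
  have := mx (v, w); rewrite /= nvw eq_sym nwv => /(_ isT); rewrite -/(D w); lia.
move=> w; rewrite inE => nuw; have := rel_degree_sub w se; rewrite -/(D w).
have : D w <= D v.
  have [->//|nwu] := eqVneq w u.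
  by have := mx (u, w); rewrite /= nuw eq_sym nwu => /(_ isT); lia.
lia.
Qed.

End HamCycle.

Section Cone.
Variables (T : finType) (W : {set T}).
Implicit Types (e : rel T) (u v x : T).

Let someI : injective (@Some T). Proof. by move=> x y []. Qed.

(** Joining a new vertex to W reduces Hamiltonian paths to Hamiltonian cycles:
    with W everything one gets all Hamiltonian paths, and with W = {x, y} those
    from x to y. *)
Definition cone e : rel (option T) := fun a b =>
  match a, b with
  | Some x, Some y => e x y
  | Some x, None | None, Some x => x \in W
  | None, None => false
  end.

Lemma cone_sym e : symmetric e -> symmetric (cone e).
Proof. by move=> es [x|] [y|] //=. Qed.

Lemma cone_irrefl e : irreflexive e -> irreflexive (cone e).
Proof. by move=> ei [x|] /=. Qed.

Lemma cone_degree e x : rel_degree (cone e) (Some x) = rel_degree e x + (x \in W).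
Proof.
rewrite /rel_degree -[in RHS](card_imset _ someI) [LHS](cardsD1 None) inE addnC.
congr (_ + _); apply: eq_card => -[y|]; last first.
  by rewrite !inE /=; apply/esym/imsetP => -[].
by rewrite !inE /= (mem_imset _ _ someI) inE.
Qed.

Lemma cone_add_edge e u v : cone (add_edge e u v) =2 add_edge (cone e) (Some u) (Some v).
Proof. by move=> [x|] [y|]; rewrite /add_edge /= ?andbF ?orbF. Qed.

(** The cycle has one more vertex, which costs 1 in the degree sum, but u and v
    gain 1 each if they lie in W. The degree sum required is thus #|T| - 1 when
    W is everything, and #|T| + 1 suffices for every W. *)
Lemma cone_ore e u v : symmetric e -> irreflexive e -> ~~ e u v -> u != v ->
  #|T|.+1 <= rel_degree e u + rel_degree e v + ((u \in W) + (v \in W)) ->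
  ham_cycle (cone (add_edge e u v)) -> ham_cycle (cone e).
Proof.
move=> es ei nuv neuv le [c [cc uc fc]].
apply: (@ore_closure _ (cone e) (Some u) (Some v)) => //.
- exact: cone_sym.
- exact: cone_irrefl.
- by rewrite card_option !cone_degree; lia.
by exists c; rewrite -(eq_cycle (cone_add_edge e u v)).
Qed.

Lemma cone_ham_path e : 0 < #|T| -> ham_cycle (cone e) ->
  exists x p, [/\ path e x p, uniq (x :: p), forall z, z \in x :: p, x \in W & last x p \in W].
Proof.
move=> /card_gt0P[x0 _] [c [cc uc fc]].
have [i q ec] := rot_to (fc None).
have uq : uniq (None :: q) by rewrite -ec rot_uniq.
have fq z : z \in None :: q by rewrite -ec mem_rot.
have cq : cycle (cone e) (None :: q) by rewrite -ec rot_cycle.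
have [p ep] : exists p, q = map Some p.
  exists (pmap id q); move: uq => /= /andP[+ _]; elim: (q) => [//|[x|] s IH] //=.
  by rewrite inE => /norP[_ /IH <-].
case: p ep => [|x p] ep.
  by have := fq (Some x0); rewrite ep.
exists x, p; move: uq cq fq; rewrite ep /= rcons_path last_map.
case/and3P=> _; rewrite (mem_map someI) (map_inj_uniq someI) => -> ->.
case/and3P=> xW; rewrite path_map => pe lW fq; split=> //.
by move=> z; have := fq (Some z); rewrite !inE /= (mem_map someI).
Qed.

Lemma cone_ham_cycle e x p : path e x p -> uniq (x :: p) -> (forall z, z \in x :: p) ->
  x \in W -> last x p \in W -> ham_cycle (cone e).
Proof.
move=> pe up fp xW lW; exists (None :: map Some (x :: p)); split.
- by rewrite /= rcons_path path_map last_map xW pe /= lW.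
- rewrite cons_uniq (map_inj_uniq someI) up andbT.
  by apply/mapP => -[].
- by case=> [z|]; rewrite ?mem_head // inE (mem_map someI) fp orbT.
Qed.

End Cone.

Lemma complete_path (T : finType) (e : rel T) x p : (forall x y, x != y -> e x y) ->
  uniq (x :: p) -> path e x p.
Proof.
move=> full; elim: p x => //= a p IH x /andP[]; rewrite inE => /norP[nxa _] up.
by rewrite full //= IH.
Qed.

Section SGraphChvatal.
Variable G : sgraph.

Let esym : symmetric (@sedge G) := @sedge_sym G.
Let eirr : irreflexive (@sedge G) := @sedge_irrefl G.

Lemma not_hamiltonian_witness : 2 < #|G| -> ~ hamiltonian G ->
  chvatal_witness 1 (@sedge G).
Proof.
move=> G3 nH; apply: (chvatal_degrees (P := @ham_cycle G)) => //.
- move=> e full ei; exists (enum G); split; [|exact: enum_uniq|by move=> z; rewrite mem_enum].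
  case ep : (enum G) => [|x p] //=; have : uniq (x :: p) by rewrite -ep enum_uniq.
  move=> up; rewrite rcons_path complete_path //= full //.
  have : 1 < size (x :: p) by rewrite -ep -cardE ltnW.
  case/lastP: p up {ep} => [//|p y] /=; rewrite mem_rcons last_rcons inE => /andP[/norP[+ _] _].
  by rewrite eq_sym.
- move=> e u v es ei nuv neuv le; apply: ore_closure => //; lia.
- case=> c [cc uc fc]; apply: nH; exists c; split=> //.
  by rewrite -(card_uniqP uc) (leq_trans G3) // -(eq_card fc) leqnn.
Qed.

Lemma not_traceable_witness : 0 < #|G| -> ~ traceable G ->
  chvatal_witness 0 (@sedge G).
Proof.
move=> G0 nT; apply: (chvatal_degrees (P := fun e => ham_cycle (cone setT e))) => //.
- move=> e full ei; case ep : (enum G) => [|x p].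
    by move: G0; rewrite cardE ep.
  apply: (@cone_ham_cycle _ _ _ x p); rewrite ?inE // -?ep ?enum_uniq //.
    by apply: complete_path; rewrite // -ep enum_uniq.
  by move=> z; rewrite mem_enum.
- move=> e u v es ei nuv neuv le; apply: cone_ore => //; rewrite !inE; lia.
- move/(cone_ham_path G0)=> [x [p [pe up fp _ _]]]; apply: nT; exists x, p; split=> //.
Qed.

(** The two ends x and y are fixed, and the new vertex is joined to both of
    them. *)
Lemma not_ham_connected_witness : ~ ham_connected G -> chvatal_witness 2 (@sedge G).
Proof.
move=> nC.
have [x [y [nxy nxyP]]] : exists x y : G, x != y /\ ~ exists p, ham_path x p /\ last x p = y.
  apply: NNPP => h; apply: nC => x y nxy; apply: NNPP => h'; apply: h; exists x, y; split=> //.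
apply: (chvatal_degrees (P := fun e => ham_cycle (cone [set x; y] e))) => //.
- move=> e full ei; pose p := rcons (filter (predC (pred2 x y)) (enum G)) y.
  have up : uniq (x :: p).
    rewrite /p /= mem_rcons inE (negPf nxy) mem_filter /= eqxx /=.
    by rewrite rcons_uniq mem_filter /= eqxx orbT /= filter_uniq // enum_uniq.
  have fp z : z \in x :: p.
    rewrite /p inE mem_rcons inE mem_filter mem_enum /= negb_or andbT.
    by case: eqP => //=; case: eqP.
  apply: (cone_ham_cycle (complete_path full up) up fp); first by rewrite !inE eqxx.
  by rewrite last_rcons !inE eqxx orbT.
- move=> e u v es ei nuv neuv le; apply: cone_ore => //; lia.
have G0 : 0 < #|G| by apply/card_gt0P; exists x.
move/(cone_ham_path G0)=> [a [p [pe up fp aW bW]]]; apply: nxyP.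
have nab : a != last a p.
  case/lastP: p up fp {pe bW} => [_ fp|p b /= + _].
    by have := fp x; have := fp y; rewrite !inE => /eqP e1 /eqP e2; move: nxy; rewrite e1 e2 eqxx.
  by rewrite mem_rcons last_rcons inE => /andP[/norP[]].
move: aW bW; rewrite !inE => /orP[]/eqP ea /orP[]/eqP eb.
- by rewrite eb ea eqxx in nab.
- by exists p; rewrite -ea -eb; split.
2: by rewrite eb ea eqxx in nab.
have erev : last (last a p) (rev (belast a p)) = a.
  by rewrite -[LHS]/(last a (_ :: _)) -rev_rcons -lastI rev_cons last_rcons.
exists (rev (belast a p)); rewrite -eb -ea erev; split=> //.
have ep : last a p :: rev (belast a p) = rev (a :: p) by rewrite [a :: p]lastI rev_rcons.
split; last by move=> z; rewrite ep mem_rev.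
  by rewrite rev_path; apply: sub_path pe => s t; rewrite sedge_sym.
by rewrite ep rev_uniq.
Qed.
End SGraphChvatal.

(** * Deleting vertices of small degree *)

(** The size of the join of an independent set of n - y vertices with T_q(y).
    With q = r - 1 it bounds the size of a K_{r+1}-free graph of maximum degree
    y. *)
Definition join_size q n y := y * (n - y) + turan_size q y.

Section Core.
Variables (G : sgraph) (q : nat).
Hypotheses (q_gt0 : 0 < q) (cb : clique_bounded [set: G] q.+1).
Implicit Types (A M S H : {set G}) (x y z w s : G).
Let n := #|G|.

Lemma degree_sum_setT S :
  2 * num_edges G + degree_sum S = degree_sum (~: S) + 2 * \sum_(x in S) degree x.
Proof.
rewrite handshake (degree_sum_split (subsetT S)) setTD; congr (_ + 2 * _).
by apply: eq_bigr => x _; rewrite degree_inT.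
Qed.

Lemma degree_split S x : degree x = degree_in S x + degree_in (~: S) x.
Proof. by rewrite -degree_inT (degree_in_split _ (subsetT S)) setTD. Qed.

(** The set S is minimal among the subsets of M whose deletion brings the
    maximum degree down to D. If S is not empty, then putting back one of its
    vertices raises a degree above D, and it can raise a degree by at most one,
    so that D is attained. *)
Lemma delete_low_degree M D : {in M, forall x, degree x <= D} ->
  {in ~: M, forall x, degree_in (~: M) x <= D} ->
  exists2 S : {set G}, S \subset M & {in ~: S, forall x, degree_in (~: S) x <= D} /\
    (S = set0 \/ exists2 w, w \in ~: S & degree_in (~: S) w = D).
Proof.
move=> degM degN.
pose P S := (S \subset M) && [forall x in ~: S, degree_in (~: S) x <= D].
have PM : P M by rewrite /P subxx; apply/forall_inP.
have [S /andP[sSM /forall_inP dS] min] := arg_minnP (fun S => #|S|) PM.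
exists S => //; split=> //; have [->|/set0Pn[s sS]] := eqVneq S set0; [by left|right].
have : ~~ P (S :\ s).
  by apply/negP => /min; rewrite [#|S|](cardsD1 s) sS add1n ltnn.
rewrite /P (subset_trans (subsetDl _ _) sSM) /= negb_forall => /existsP[w].
rewrite negb_imply -ltnNge => /andP[wS ltD].
have eS : ~: (S :\ s) = s |: ~: S by rewrite setCD setUC.
have nws : w != s.
  apply: contraTneq ltD => ->; rewrite -leqNgt; apply: leq_trans (degM s _); last exact: subsetP sS.
  by rewrite -degree_inT degree_in_sub ?subsetT.
have wH : w \in ~: S by move: wS; rewrite eS !inE (negPf nws).
exists w => //; apply/eqP; rewrite eqn_leq dS //= -ltnS; apply: leq_trans ltD _.
rewrite eS (@degree_in_split _ (s |: ~: S) [set s]) ?sub1set ?setU11 // -add1n leq_add //.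
  by rewrite (leq_trans (degree_in_le _ _)) ?cards1.
by apply: degree_in_sub; apply/subsetP => z; rewrite !inE; case: eqP.
Qed.

(** After the deletion the maximum degree is exactly D unless nothing was
    deleted. In the former case the deleted vertices contribute at most D each,
    which is what they would contribute to the independent set of the join, so
    the bound for the remaining graph becomes the bound for all n vertices. *)
Lemma low_degree_bound M D : 0 < n -> {in M, forall x, degree x <= D} ->
  {in ~: M, forall x, degree_in (~: M) x <= D} ->
  exists2 y, y <= D /\ y < n & num_edges G <= join_size q n y.
Proof.
move=> n_gt0 degM degN; have [S sSM [dS aS]] := delete_low_degree degM degN.
have [w wH wmax] : exists2 w, w \in ~: S &
    {in ~: S, forall x, degree_in (~: S) x <= degree_in (~: S) w}.
  apply: max_degree_in; case: aS => [->|[w wH _]]; last by apply/set0Pn; exists w.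
  by rewrite setC0 -card_gt0 cardsT.
have bnd := max_degree_turan_bound q_gt0 (clique_bounded_sub (subsetT _) cb) wH erefl wmax.
have sum_le : \sum_(x in S) degree x <= #|S| * D.
  by rewrite -sum_nat_const leq_sum // => x /(subsetP sSM)/degM.
have e := degree_sum_setT S.
have cS : #|S| + #|~: S| = n by rewrite cardsC.
have ltH := degree_in_lt wH.
exists (degree_in (~: S) w); first by split; [exact: dS|lia].
rewrite /join_size; case: aS => [S0|[w' w'H eD]].
  move: cS bnd sum_le e; rewrite S0 cards0 mul0n /degree_sum !big_set0; nia.
have ew : degree_in (~: S) w = D.
  by apply/eqP; rewrite eqn_leq dS //= -{1}eD wmax.
rewrite ew in bnd ltH *.
have : n - D = #|S| + (#|~: S| - D) by lia.
nia.
Qed.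

Lemma mem_turan_parts D k : k \in turan_parts q D -> D %/ q <= k <= (D %/ q).+1.
Proof.
by rewrite mem_cat !mem_nseq => /orP[]/andP[_ /eqP->]; rewrite leqnn leqnSn.
Qed.

Lemma mem_turan_parts_small D k : D <= q -> k \in turan_parts q D -> k <= 1.
Proof.
move=> leD; rewrite mem_cat !mem_nseq.
have [->|neD] := eqVneq D q.
  by rewrite modnn divnn q_gt0 /= orbF => /andP[_ /eqP->].
by rewrite divn_small ?ltn_neqAle ?neD // => /orP[]/andP[_ /eqP->].
Qed.

(** Let H be the graph left by the deletion of S. Equality makes S independent
    with all degrees D, and H a complete multipartite graph in which every part
    has at least #|H| - D vertices, because its maximum degree is D. Each s in
    S misses #|H| - D vertices of H. These contain a whole part, as otherwise s
    and one neighbour from each part form a large clique or, when some part is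
    empty, every part has one vertex and s misses none; so they are exactly one
    part. Since M has at least n - D elements, it contains a vertex x0 outside
    S. Its degree is at most D, and this excludes all neighbours in S, so every
    s in S misses the part of x0 and belongs to it. *)
Lemma low_degree_eq M D : 0 < D -> D < n -> {in M, forall x, degree x <= D} ->
  {in ~: M, forall x, degree_in (~: M) x <= D} -> n - D <= #|M| ->
  D %/ q + 1 < n - D ->
  (forall y : nat, y < D -> join_size q n y < join_size q n D) ->
  join_size q n D <= num_edges G ->
  exists2 c, multipartite_on [set: G] q.+1 c &
    perm_eq (part_sizes [set: G] q.+1 c) ((n - D) :: turan_parts q D).
Proof.
move=> D_gt0 ltDn degM degN cM lt_part mono ge.
have n_gt0 : 0 < n by lia.
have [S sSM [dS aS]] := delete_low_degree degM degN.
set H := ~: S in dS aS; have eH : ~: S = H by [].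
have mH x : (x \in H) = (x \notin S) by rewrite inE.
have e := degree_sum_setT S; have cS : #|S| + #|H| = n by rewrite cardsC.
rewrite eH in e; clearbody H.
have sum_le : \sum_(x in S) degree x <= #|S| * D.
  by rewrite -sum_nat_const leq_sum // => x /(subsetP sSM)/degM.
have cbH : clique_bounded H q.+1 := clique_bounded_sub (subsetT _) cb.
have [w wH wD] : exists2 w, w \in H & degree_in H w = D.
  case: aS => [S0|//].
  have [|w wH wmax] := @max_degree_in _ H.
    by rewrite -eH S0 setC0 -card_gt0 cardsT.
  exists w => //; apply/eqP; rewrite eqn_leq dS //= leqNgt; apply/negP => /mono.
  have := max_degree_turan_bound q_gt0 cbH wH erefl wmax.
  have cH : #|H| = n by rewrite -cS S0 cards0.
  move: e ge; rewrite cH S0 /degree_sum !big_set0 -/(degree_sum H) /join_size; lia.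
have wmax : {in H, forall x, degree_in H x <= D} := dS.
have bnd := max_degree_turan_bound q_gt0 cbH wH wD wmax.
have ltH := degree_in_lt wH; rewrite wD in ltH.
have eB : join_size q n D = #|S| * D + (D * (#|H| - D) + turan_size q D).
  have -> : #|S| * D = D * #|S| by rewrite mulnC.
  by rewrite addnA -mulnDr /join_size; congr (D * _ + _); lia.
have eS0 : degree_sum S = 0 by lia.
have geH : 2 * (D * (#|H| - D) + turan_size q D) <= degree_sum H by lia.
have eSD : \sum_(x in S) degree x = #|S| * D by lia.
have degS s : s \in S -> degree s = D.
  move=> sS; apply/eqP; have := @leqif_sum _ (fun x => x \in S) (fun x => degree x == D)
    (fun x => degree x) (fun=> D).
  case=> [x /(subsetP sSM)/degM lx|_]; first by split.
  by rewrite eSD sum_nat_const eqxx => /esym/forall_inP; apply.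
have indS s t : s \in S -> t \in S -> (s -- t) = false.
  move=> sS tS; apply/negP => st.
  move/eqP: eS0; rewrite /degree_sum sum_nat_eq0 => /forall_inP/(_ s sS).
  by rewrite cards_eq0 => /eqP/setP/(_ t); rewrite !inE tS st.
have [eN hN] := max_degree_turan_eq q_gt0 cbH wH wD wmax geH.
set N := [set x in H | w -- x] in eN hN.
have cN : #|N| = D by rewrite -wD.
have sNH : N \subset H by apply/subsetP => x; rewrite inE => /andP[].
have cbN : clique_bounded N q by apply: clique_bounded_nbr.
have wN : w \notin N by rewrite inE sedge_irrefl andbF.
clearbody N.
have [c0 mc0] : exists c0, multipartite_on N q c0.
  by apply: turan_unique => //; rewrite cN eN.
have pN : perm_eq (part_sizes N q c0) (turan_parts q D).
  by have := part_sizes_turan q_gt0 mc0; rewrite cN eN; apply.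
have := multipartite_extend sNH mc0 hN.
set c1 := (fun x => if x \in N then c0 x else q) => mc1.
have [c1r c1E] := mc1.
pose cl x := [set z in H | c1 z == c1 x].
have degH x : x \in H -> degree_in H x + #|cl x| = #|H|.
  exact: degree_in_multipartite mc1.
have cl_ge x : x \in H -> #|H| - D <= #|cl x|.
  by move=> xH; have := degH x xH; have := dS x xH; lia.
have clN x : x \in N -> #|cl x| \in turan_parts q D.
  move=> xN; rewrite -(perm_mem pN); apply/mapP; exists (c0 x).
    by rewrite mem_iota /= mc0.1.
  apply: eq_card => z; rewrite !inE /c1 xN.
  case: (boolP (z \in N)) => zN; first by rewrite (subsetP sNH z zN).
  by rewrite gtn_eqF ?andbF // mc0.1.
have clV x : x \in H -> x \notin N -> #|cl x| = #|H| - D.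
  move=> xH xN; rewrite -cN -(setIidPr sNH) -cardsD; apply: eq_card => z.
  rewrite !inE /c1 (negPf xN); case: (boolP (z \in N)) => zN; last by rewrite eqxx andbT.
  by rewrite ltn_eqF ?andbF // mc0.1.
pose Z s := [set z in H | ~~ (s -- z)].
have cZ s : s \in S -> #|Z s| = #|H| - D.
  move=> sS; have e1 : degree_in H s = D.
    rewrite -(degS s sS) (degree_split S) eH.
    suff -> : degree_in S s = 0 by [].
    apply/eqP; rewrite cards_eq0; apply/eqP/setP => t; rewrite !inE.
    by case: (boolP (t \in S)) => //= /(indS s t sS).
  rewrite -e1 -[in RHS](cardsID [set z | s -- z] H).
  rewrite [degree_in H s](_ : _ = #|H :&: [set z | s -- z]|).
    by rewrite addKn; apply: eq_card => z; rewrite !inE andbC.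
  by apply: eq_card => z; rewrite !inE.
(* Inside H, a deleted vertex misses |H| - D vertices, which form one part. *)
have missing s : s \in S -> exists2 z, z \in H & Z s = cl z.
  move=> sS.
  suff [z zH sub] : exists2 z, z \in H & cl z \subset Z s.
    by exists z => //; apply/esym/eqP; rewrite eqEcard sub cZ // cl_ge.
  have [/exists_inP[z zH sub]|] := boolP [exists z in H, cl z \subset Z s]; first by exists z.
  rewrite negb_exists => /forallP no; exfalso.
  have {}no z : z \in H -> exists2 z', z' \in H & c1 z' = c1 z /\ s -- z'.
    move=> zH; have := no z; rewrite zH /= => /subsetPn[z' ]; rewrite !inE => /andP[z'H /eqP ez].
    by rewrite z'H /= negbK => sz; exists z'; rewrite ?inE.
    (* If q <= D every part is nonempty; if D < q every part in N is a singleton. *)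
have [leqD|ltDq] := leqP q D.
    have rep (j : 'I_q.+1) : exists z, [&& z \in H, c1 z == j & s -- z].
      suff [z zH ez] : exists2 z, z \in H & c1 z = j.
        by have [z' z'H [e1 e2]] := no z zH; exists z'; rewrite z'H e1 ez eqxx.
      have [ltj|] := ltnP j q; last first.
        move=> lej; have -> : val j = q by apply/eqP; rewrite eqn_leq lej -ltnS ltn_ord.
        by exists w => //; rewrite /c1 (negPf wN).
      have : nth 0 (part_sizes N q c0) j \in turan_parts q D.
        by rewrite -(perm_mem pN) mem_nth // size_map size_iota.
      move/mem_turan_parts => /andP[+ _]; rewrite (nth_map 0) ?size_iota // nth_iota // add0n.
      have : 0 < D %/ q by rewrite divn_gt0.
      move=> h1 h2; have /card_gt0P[z] := leq_trans h1 h2; rewrite inE => /andP[zN /eqP ez].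
      by exists z; rewrite ?(subsetP sNH) // /c1 zN.
    pose f j := xchoose (rep j).
    have fP j : [/\ f j \in H, c1 (f j) = j & s -- f j].
      by have /and3P[? /eqP ? ?] := xchooseP (rep j).
    have inj_f : injective f.
      move=> j k ejk; apply: val_inj => /=.
      by have [_ e1 _] := fP j; have [_ e2 _] := fP k; rewrite -e1 -e2 ejk.
    have := cb (K := s |: [set f j | j : 'I_q.+1]) (subsetT _).
    rewrite cardsU1 card_imset // card_ord.
    have -> : s \notin [set f j | j : 'I_q.+1].
      by apply/imsetP => -[j _ es]; have [] := fP j; rewrite -es mH sS.
    rewrite add1n ltnn; suff cK : is_clique (s |: [set f j | j : 'I_q.+1]) by move/(_ cK).
    move=> x y; rewrite !inE => /orP[/eqP->|/imsetP[j _ ->]] /orP[/eqP->|/imsetP[k _ ->]].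
    - by rewrite eqxx.
    - by have [] := fP k.
    - by have [_ _] := fP j; rewrite sedge_sym.
    have [jH ej _] := fP j; have [kH ek _] := fP k; move=> njk.
    by rewrite c1E // ej ek; apply: contra njk => /eqP/val_inj->.
  have [x xN] : exists x, x \in N by apply/card_gt0P; rewrite cN.
  have cx : #|cl x| <= 1 := mem_turan_parts_small (ltnW ltDq) (clN x xN).
  have cH1 : #|H| - D <= 1 := leq_trans (cl_ge x (subsetP sNH x xN)) cx.
  have [z] : exists z, z \in Z s by apply/card_gt0P; rewrite cZ // subn_gt0.
  rewrite inE => /andP[zH nsz]; have [z' z'H [ez sz']] := no z zH.
  have cz : #|cl z| <= 1.
    have [zN|zN] := boolP (z \in N); last by rewrite clV.
    exact: mem_turan_parts_small (ltnW ltDq) (clN z zN).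
  have ezz : z' = z by apply: (card_le1_eqP cz); rewrite inE ?ez ?eqxx ?andbT.
  by rewrite -ezz sz' in nsz.
have [x0 x0M x0S] : exists2 x, x \in M & x \notin S.
  apply/subsetPn; apply/negP => /subset_leq_card; lia.
have x0H : x0 \in H by rewrite mH.
(* A neighbour of x0 in S would force the part of x0 to be larger than #|H| - D;
   then x0 would be adjacent to all of S, and its part would have at least n - D
   vertices. *)
have Zx0 s : s \in S -> Z s = cl x0.
  move=> sS; have [z zH ez] := missing s sS.
  suff x0Z : x0 \in Z s.
    by move: (x0Z); rewrite ez => /setIdP[_ /eqP e1]; apply/setP => u; rewrite !inE e1.
  rewrite inE x0H /=; apply/negP => sx0.
  have deg0 := degM x0 x0M; rewrite (degree_split S) eH in deg0.
  have d0 := degH x0 x0H.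
  have pos : 0 < degree_in S x0.
    by apply/card_gt0P; exists s; rewrite inE sS sedge_sym.
  have allS : degree_in S x0 = #|S|.
    apply/eq_card => t; rewrite inE; case: (boolP (t \in S)) => //= tS.
    have [z' z'H ez'] := missing t tS; apply/negPn/negP => ntx.
    have : x0 \in Z t by rewrite inE x0H sedge_sym.
    rewrite ez' => /setIdP[_ /eqP e1].
    have : #|cl x0| = #|H| - D by rewrite -(cZ t tS) ez'; apply: eq_card => u; rewrite !inE e1.
    by move: deg0 d0 pos ltH; clear; lia.
  have x0N : x0 \in N.
    apply/negPn/negP => x0N; have := clV x0 x0H x0N.
    by move: deg0 d0 pos ltH; clear; lia.
  have /andP[_] := mem_turan_parts (clN x0 x0N).
  by move: deg0 d0 allS cS ltH lt_part; clear; lia.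
(* The set S joins the part of x0, which then has n - D vertices. *)
pose c x := if x \in S then c1 x0 else c1 x.
have mc : multipartite_on [set: G] q.+1 c.
  have SZ s z : s \in S -> z \in H -> s -- z = (c1 z != c1 x0).
    move=> sS zH; have := Zx0 s sS => /setP/(_ z); rewrite !inE zH /= => <-.
    by rewrite negbK.
  split=> [x _|x y _ _]; rewrite /c.
    by case: ifP => xS; rewrite c1r // mH xS.
  case: (boolP (x \in S)) => xS; case: (boolP (y \in S)) => yS.
  - by rewrite eqxx indS.
  - by rewrite SZ ?mH // eq_sym.
  - by rewrite sedge_sym SZ ?mH.
  - by rewrite c1E ?mH.
exists c => //.
have cx0 : #|[set x in [set: G] | c x == c1 x0]| = n - D.
  have -> : [set x in [set: G] | c x == c1 x0] = S :|: cl x0.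
    by apply/setP => x; rewrite !inE mH /c; case: (x \in S); rewrite ?eqxx.
  have -> : n - D = #|S| + (#|H| - D) by move: cS ltH; clear; lia.
  rewrite cardsU (_ : S :&: cl x0 = set0) ?cards0 ?subn0; last first.
    by apply/setP => x; rewrite !inE mH; case: (x \in S).
  congr (_ + _); have [S0|/set0Pn[s sS]] := eqVneq S set0; last by rewrite -(Zx0 s sS) cZ.
  apply: clV => //; apply/negP => x0N.
  have := cl_ge x0 x0H; have /andP[_] := mem_turan_parts (clN x0 x0N).
  by move: cS lt_part; rewrite S0 cards0; clear; lia.
have szp : size (part_sizes [set: G] q.+1 c) = q.+1 by rewrite size_map size_iota.
have mp : n - D \in part_sizes [set: G] q.+1 c.
  by rewrite -cx0; apply/mapP; exists (c1 x0); rewrite // mem_iota /= c1r.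
have pp := perm_to_rem mp; apply: (perm_trans pp); rewrite perm_cons.
have sq := degree_sum_multipartite mc; have sm := sumn_part_sizes mc.1.
have szt := size_rem mp; rewrite szp in szt.
move: (rem _ _) pp szt => t pp szt.
rewrite cardsT -/n -handshake /sumsq (perm_sumn (perm_map _ pp)) /= -/(sumsq _) in sq.
rewrite cardsT -/n (perm_sumn pp) /= in sm.
have smt : sumn t = D by move: sm ltDn; clear; lia.
rewrite -smt; apply: balanced_parts => //.
have : (n - D) + D = n by rewrite subnK // ltnW.
rewrite smt; rewrite /join_size in ge; move: (n - D) sq ge => a sq ge en.
by rewrite -en in sq; move: sq ge; clear; lia.
Qed.

End Core.

(** * The edge bound *)

Lemma join_sizeS q n y : y < n ->
  join_size q n y.+1 + y + y %/ q + 1 = join_size q n y + n.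
Proof.
move=> lt; rewrite /join_size [turan_size q y.+1]/=; have := leq_div y q.
have -> : n - y = (n - y.+1).+1 by lia.
have : n = (n - y.+1) + y.+1 by lia.
move: (n - y.+1) => a ->; nia.
Qed.

Lemma join_size_mono q n D y : D + D %/ q < n -> y < D ->
  join_size q n y < join_size q n D.
Proof.
elim: D => // D IH ltD ltyD.
have le1 : D %/ q <= D.+1 %/ q := leq_div2r q (leqnSn D).
have step : join_size q n D < join_size q n D.+1.
  have ltDn : D < n by apply: leq_trans (leq_addr _ _) (ltnW ltD).
  have := join_sizeS q ltDn; move: (D %/ q) (D.+1 %/ q) le1 ltD => a b; lia.
have [->//|ne] := eqVneq y D.
apply: ltn_trans step; apply: IH; last by lia.
by move: (D %/ q) (D.+1 %/ q) le1 ltD => a b; lia.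
Qed.

(** Beyond the size of the complement of a smallest part of T_{q+1}(m), the
    join is too unbalanced and decreases in y. *)
Lemma join_size_anti q m D y : 0 < q -> m - m %/ q.+1 <= D -> D < y -> y <= m ->
  join_size q m y < join_size q m D.
Proof.
move=> q_gt0 leD; elim: y => // y IH ltDy lty.
have ley : q * (m %/ q.+1) <= y.
  by have := leq_divM m q.+1; move: (m %/ q.+1) leD => p leD; nia.
have ldiv : m %/ q.+1 <= y %/ q by rewrite leq_divRL // mulnC.
have step : join_size q m y.+1 < join_size q m y.
  have := join_sizeS q lty; move: (m %/ q.+1) (y %/ q) ldiv ltDy leD => a b; lia.
have [->//|ne] := eqVneq D y; apply: ltn_trans step _; apply: IH; lia.
Qed.

Lemma turan_gap_mono r j k : j <= k -> j - j %/ r <= k - k %/ r.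
Proof.
elim: k => [|k IH]; first by rewrite leqn0 => /eqP->.
rewrite leq_eqVlt => /predU1P[->//|/IH h]; apply: leq_trans h _.
have [->|r_gt0] := posnP r; first by rewrite !divn0 !subn0.
by rewrite divnS //; have := leq_div k r; case: (_ %| _); lia.
Qed.

Lemma turan_gap2 r j : 1 < r -> (j - j %/ r).+1 <= j.+2 - j.+2 %/ r.
Proof.
move=> r_gt1; rewrite !divnS ?(ltnW r_gt1) //; have := leq_div j r.
have : (r %| j.+1) + (r %| j.+2) <= 1.
  case: (boolP (r %| j.+1)) => d1; case: (boolP (r %| j.+2)) => d2 //.
  by move: d2; rewrite -addn1 dvdn_addr // dvdn1 => /eqP e; rewrite e in r_gt1.
lia.
Qed.

Lemma turan_size_addn r m k : turan_size r m + k * (m - m %/ r) <= turan_size r (m + k).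
Proof.
elim: k => [|k IH]; first by rewrite addn0 mul0n addn0.
rewrite addnS /= mulSn; have := turan_gap_mono r (leq_addr k m); lia.
Qed.

Lemma muln_index_degree i L : 0 < i -> i * (i + L - 1) = (i - 1) * (i + L) + L.
Proof. by case: i => // i _; rewrite subSS subn0; nia. Qed.

(** The number of edges gained from T_r(j) to T_r(j + 1). *)
Definition turan_gap r j := j - j %/ r.

(** The numeric facts on which the edge bound depends. Here i is the largest
    possible index in the degree condition, D the corresponding degree. The
    first condition makes join_size increasing up to D. The second condition
    compares the extremal join for this i with the claimed bound, and is strict
    when 2 * i + L < n; the last two compare the bounds for i = 2 and i = 3
    with the one for i = 1. *)
Definition tame q L n :=
  let i := (n - L)./2 in let D := i + L - 1 in
  [/\ D < q * i, join_size q n D + odd (n - L) <= turan_size q.+1 n.-1 + L,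
      (L + 5 <= n -> L + 2 < turan_gap q.+1 n.-2) &
      (L + 7 <= n -> L + 3 < turan_gap q.+1 n.-2)].

(** The graphs attaining the bound without having a vertex of degree L. *)
Definition extremal_multipartite q L (G : sgraph) :=
  let n := #|G| in let i := (n - L)./2 in let D := i + L - 1 in
  [/\ 2 <= i, n = 2 * i + L, join_size q n D = turan_size q.+1 n.-1 + L &
   exists2 c, multipartite_on [set: G] q.+1 c &
      perm_eq (part_sizes [set: G] q.+1 c) (i.+1 :: turan_parts q D)].

Lemma clique_bounded_del (G : sgraph) (S : {set G}) r : clique_bounded [set: G] r ->
  clique_bounded [set: del_vertices S] r.
Proof.
move=> cbr K _ cK; rewrite -(card_imset _ val_inj); apply: cbr; first exact: subsetT.
move=> _ _ /imsetP[x xK ->] /imsetP[y yK ->] ne; apply: (cK x y xK yK).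
by apply: contra ne => /eqP->.
Qed.

Lemma small_degree_bound (G : sgraph) r (v : G) : 0 < r -> clique_bounded [set: G] r ->
  num_edges G <= turan_size r #|G|.-1 + degree v.
Proof.
move=> r_gt0 cbr; rewrite (num_edges_del1 v) leq_add2r.
rewrite -(leq_pmul2l (isT : 0 < 2)) num_edges_del.
have := turan_bound r_gt0 (clique_bounded_sub (subsetT (~: [set v])) cbr).
by rewrite -[#|~: _|]/(#|~: [set v]|) cardsC1.
Qed.

(** The case i = 1 of the degree condition: by the uniqueness part of the
    theorem of Turan, deleting v leaves the Turan graph. *)
Lemma small_degree_eq (G : sgraph) L r (v : G) : 0 < r -> clique_free G r.+1 -> degree v <= L ->
  turan_size r #|G|.-1 + L <= num_edges G -> calG (L%:Z - 1)%R #|G| r G.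
Proof.
move=> r_gt0 cf leL ge; have cbr := clique_freeP cf.
have cD : #|del_vertices [set v]| = #|G|.-1 by rewrite card_sub_set cardsC1.
have b := small_degree_bound v r_gt0 cbr.
split=> //; exists v; split; last by lia.
rewrite -cD; apply: iso_turan => //; first exact: clique_bounded_del.
by rewrite cD; have := num_edges_del1 v; lia.
Qed.

Section Main.
Variables (G : sgraph) (q L : nat).
Hypotheses (q_gt0 : 0 < q) (cb : clique_bounded [set: G] q.+1).
Let n := #|G|.

(** The bound when the maximum degree y outside A exceeds D, so that deleting
    all of A is not enough to bring it down to D. *)
Lemma low_set_bound (A : {set G}) i D y w : #|A| = i -> {in A, forall x, degree x <= D} ->
  w \in ~: A -> degree_in (~: A) w = y -> {in ~: A, forall x, degree_in (~: A) x <= y} ->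
  num_edges G <= i * D + join_size q (n - i) y.
Proof.
move=> cA degA wA ew wmax; have e := degree_sum_setT A.
have bnd := max_degree_turan_bound q_gt0 (clique_bounded_sub (subsetT _) cb) wA ew wmax.
have : \sum_(x in A) degree x <= #|A| * D.
  by rewrite -sum_nat_const leq_sum.
have cS : #|~: A| = n - i by rewrite -cA /n -(cardsC A) addKn.
rewrite cS in bnd; rewrite cA /join_size; lia.
Qed.

(** If n = 2 * i + L, the n - D vertices of M have degree at most D, and the D
    remaining vertices have degree below D among themselves, so that the join
    bound applies and is attained only by a complete multipartite graph.
    Otherwise i vertices of A are deleted. Either the join bound applies again
    and is strict, or the maximum degree y left is above D. In that case, if D
    is at least the degree n - i - (n - i) / r of T_r(n - i), then lowering y
    to D increases the bound; and if not, each of the n - i, ..., n - 2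
    vertices added on the way from T_r(n - i) to T_r(n - 1) gains more than D
    edges. *)
Lemma many_low_degrees i (A M : {set G}) : 2 <= i -> 2 * i + L <= n ->
  i <= #|A| -> {in A, forall x, degree x < i + L} ->
  n < #|M| + i + L -> {in M, forall x, degree x + i < n} ->
  tame q L n ->
  num_edges G <= turan_size q.+1 n.-1 + L /\
  (num_edges G = turan_size q.+1 n.-1 + L -> extremal_multipartite q L G).
Proof.
move=> i2 le_n cA degA cM degM [].
set i0 := (n - L)./2; set D0 := i0 + L - 1 => T1 T2 T3 T4.
have eodd : n - L = odd (n - L) + i0 + i0.
  by rewrite -{1}(odd_double_half (n - L)) -addnn addnA.
have lei : i <= i0 by move: eodd; case: (odd _) => /=; lia.
have n_gt0 : 0 < n by lia.
have D0q : D0 %/ q < i0 by rewrite ltn_divLR // mulnC.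
have ltD0 : D0 + D0 %/ q < n by lia.
have mono y : y < D0 -> join_size q n y < join_size q n D0 by apply: join_size_mono.
have bound y : y <= D0 -> join_size q n y <= join_size q n D0.
  by rewrite leq_eqVlt => /predU1P[->//|/mono/ltnW].
have T2' := leq_trans (leq_addr _ _) T2.
(* For n = 2 * i + L the degree bound n - i - 1 on M equals D = i + L - 1. *)
have [en|ne] := eqVneq n (2 * i + L).
  have ei : i = i0 by move: eodd; case: (odd _) => /=; lia.
  have degM' : {in M, forall x, degree x <= D0} by move=> x /degM; lia.
  have degN : {in ~: M, forall x, degree_in (~: M) x <= D0}.
    move=> x /degree_in_lt; have := cardsC M; rewrite -/n; lia.
  have [y [yD _] le] := low_degree_bound q_gt0 cb n_gt0 degM' degN.
  rewrite -/n in le; have le2 := bound y yD; split.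
    exact: leq_trans le (leq_trans le2 T2').
  move=> eqe.
  have [|||||c mc pc] := low_degree_eq q_gt0 cb _ _ degM' degN _ _ mono; rewrite -/n; try lia.
  split; rewrite -/n -/i0 -/D0; try lia.
  by exists c => //; have -> : i0.+1 = n - D0 by lia.
suff : num_edges G < turan_size q.+1 n.-1 + L by split; lia.
have lt_n : 2 * i + L < n by rewrite ltn_neqAle eq_sym ne.
have [B sBA cB] : exists2 B : {set G}, B \subset A & #|B| = i.
  exact: subset_of_card cA.
have degB : {in B, forall x, degree x <= i + L - 1}.
  by move=> x /(subsetP sBA)/degA; lia.
have leD : i + L - 1 <= D0 by lia.
have cBC : #|~: B| = n - i by rewrite -cB /n -(cardsC B) addKn.
have [w wB wmax] : exists2 w, w \in ~: B &
    {in ~: B, forall x, degree_in (~: B) x <= degree_in (~: B) w}.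
  by apply: max_degree_in; rewrite -card_gt0 cBC; lia.
have ltw := degree_in_lt wB; rewrite cBC in ltw.
have [small|big] := leqP (degree_in (~: B) w) (i + L - 1).
  have degN : {in ~: B, forall x, degree_in (~: B) x <= i + L - 1}.
    by move=> x /wmax h; apply: leq_trans h small.
  have [y [yD _] le] := low_degree_bound q_gt0 cb n_gt0 degB degN; rewrite -/n in le.
  apply: leq_ltn_trans le _.
  have [ei|nei] := eqVneq i i0; last by apply: leq_trans (mono y _) T2'; lia.
  apply: leq_ltn_trans (bound y _) _; first by lia.
  move: T2; suff -> : odd (n - L) by rewrite addn1.
  by move: eodd; case: (odd _) => //=; lia.
have bnd := low_set_bound cB degB wB erefl wmax.
set y := degree_in _ w in ltw big bnd; set D := i + L - 1 in leD big bnd degB.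
(* The maximum of join_size q (n - i) is near n - i - (n - i) / (q + 1). *)
have [gapD|gapD] := leqP ((n - i) - (n - i) %/ q.+1) D.
  have := join_size_anti q_gt0 gapD big (ltnW ltw) => lt1.
  have : i * D + join_size q (n - i) D = join_size q n D.
    have -> : i * D = D * i by rewrite mulnC.
    rewrite /join_size addnA -mulnDr; congr (D * _ + _).
    by move: big ltw lt_n; clear; lia.
  by move: (bound D leD) bnd T2' lt1; clear; lia.
have le3 := turan_size_join q_gt0 (ltnW ltw).
suff : (i - 1) * (i + L) + turan_size q.+1 (n - i) < turan_size q.+1 n.-1.
  have := @muln_index_degree i L; rewrite -/D (ltnW i2) => /(_ isT).
  by move: bnd le3; rewrite -/(join_size q (n - i) y); clear; lia.
have step k := turan_size_addn q.+1 (n - i) k.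
have en2 : n.-1 = n.-2.+1 by move: i2 le_n; clear; lia.
have gap_last : turan_size q.+1 n.-1 = turan_size q.+1 n.-2 + turan_gap q.+1 n.-2.
  by rewrite en2.
have e2 : n.-2 = (n - i) + (i - 2) by move: i2 le_n; clear; lia.
have := step (i - 2); rewrite -e2 gap_last.
have gapD' : i + L <= turan_gap q.+1 (n - i)
  by rewrite /turan_gap; move: gapD i2; rewrite /D; clear; lia.
have le2g : (i - 2) * (i + L) <= (i - 2) * turan_gap q.+1 (n - i) by rewrite leq_mul2l gapD' orbT.
rewrite -/(turan_gap _ _) => leT.
have : i + L < turan_gap q.+1 n.-2.
  have [e_i|i_ne2] := eqVneq i 2.
    by rewrite e_i addnC; apply: T3; move: lt_n; rewrite e_i; clear; lia.
  have [e_i|i_ne3] := eqVneq i 3.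
    by rewrite e_i addnC; apply: T4; move: lt_n; rewrite e_i; clear; lia.
  apply: leq_ltn_trans gapD' _; apply: leq_trans (turan_gap2 _ _) (turan_gap_mono _ _) => //.
  by move: i2 i_ne2 i_ne3 lt_n; clear; lia.
have -> : (i - 1) * (i + L) = (i - 2) * (i + L) + (i + L)
  by rewrite -mulSnr; congr (_ * _); move: i2; clear; lia.
move: (turan_gap _ _) leT le2g; clear; lia.
Qed.
End Main.

(** * The numeric conditions *)

(** The bound (1 - 1 / q) * n ^ 2 / 2, attained when q divides n. *)
Lemma turan_size_upper q n : 0 < q -> 2 * q * turan_size q n <= (q - 1) * n ^ 2.
Proof.
case: q => // q _; rewrite subSS subn0.
have := turan_size_div n (ltn0Sn q); have := divn_eq n q.+1; have := ltn_pmod n (ltn0Sn q).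
move: (n %/ q.+1) (n %% q.+1) => p s lts e; subst n.
have : s * s <= q.+1 * s by rewrite leq_mul2r ltnW ?orbT.
nia.
Qed.

(** By completing the square in the exact formula; the loss against (1 - 1 / r)
    * n ^ 2 / 2 is at most r / 8. *)
Lemma turan_size_lower r n : 0 < r -> 4 * (r - 1) * n ^ 2 <= 8 * r * turan_size r n + r ^ 2.
Proof.
case: r => // r _; rewrite subSS subn0.
have := congr1 (muln (4 * r.+1)) (turan_size_div n (ltn0Sn r)).
move: (n %/ r.+1) => p h; have [+ _] := nat_Cauchy (2 * n) (r.+1 * (2 * p + 1)).
move: (turan_size _ _) h => t; lia.
Qed.

(** The thresholds of the parts on Hamiltonian cycles and paths, merged into
    one predicate, with q = r - 1. For q >= 7 the second alternative is the
    threshold n >= k + 5 + 4 * (k + 4) / (r - 4) with k = L - 1, cleared of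
    denominators. *)
Definition admissible (q L n : nat) :=
  [|| (q == 2) && (6 * L + 20 <= n),
      (q == 3) && ((L == 0) || (5 * L + 6 <= n)),
      (4 <= q <= 6) && [|| L <= 1, 3 * L + 4 <= n | (L == 2) && (5 <= q)] |
      (7 <= q) && ((L <= 2) || (4 * n.-1 <= (n - L - 4) * q.+1))].

(** The values for which the join has exactly the claimed number of edges: the
    graphs K_{3,1,...,1} with L + 1 singletons, and nine sporadic ones. *)
Definition exceptional_index (q L i : nat) :=
  ((i == 2) && (L <= 2) && (L + 3 <= q)) ||
  ((q, L, i) \in [:: (3, 0, 3); (3, 0, 4); (4, 1, 3); (4, 1, 4); (3, 1, 5);
                     (5, 2, 3); (5, 2, 4); (4, 2, 4); (4, 3, 5)]).

(** Replacing both Turan sizes by their averaged values (1 - 1 / q) * D ^ 2 / 2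
    and (1 - 1 / r) * N ^ 2 / 2 turns the comparison into a square of q * (i +
    e) - D against linear terms. This is sharp enough for fixed r and large i. *)
Lemma gap_by_average q L i (e : bool) : 0 < q -> 0 < i + L ->
  let n := 2 * i + L + e in let D := i + L - 1 in
  D <= q * (i + e) ->
  q * q.+1 ^ 2 + 8 * q.+1 * q * (i + e) < 4 * (q * (i + e) - D) ^ 2 + 8 * q.+1 * q ->
  join_size q n D + e < turan_size q.+1 n.-1 + L.
Proof.
move=> q_gt0 iL n D leD lt.
have := turan_size_upper D q_gt0; have := turan_size_lower n.-1 (ltn0Sn q).
rewrite /join_size subSS subn0.
have eN : n.-1 = D + (i + e) by rewrite /n /D; lia.
have eD : n - D = i + e + 1 by rewrite /n /D; lia.
have eL : L + (i + e) = D + 1 + e by rewrite /D; lia.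
rewrite eN eD; move: (turan_size q D) (turan_size q.+1 _) => t u.
move: lt eL leD; clear eN eD n iL; move: D (i + e) => D j lt eL leD ht hu.
have es : (q * j - D) + D = q * j by rewrite subnK.
move: (q * j - D) es lt => x es lt.
have e1 : 4 * x ^ 2 + 8 * D * (q * j) = 4 * (q * j) ^ 2 + 4 * D ^ 2 by rewrite -es; ring.
rewrite -(ltn_pmul2l (_ : 0 < 8 * q.+1 * q)) ?muln_gt0 //.
have h1 := leq_mul (leqnn q) ht; have h2 := leq_mul (leqnn (4 * q.+1)) hu.
have h3 : 8 * q.+1 * q * (L + j) = 8 * q.+1 * q * (D + 1 + e) by rewrite eL.
case: q q_gt0 e1 h1 h2 h3 lt {leD es ht hu} => // q _; rewrite subSS subn0; clear eL.
move: (nat_of_bool e) => b; lia.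
Qed.

(** Using the supporting line of the same slope p for both Turan sizes, twice
    the difference is at least (d - 1) * (d - 2) - 2 * p with d = i + e - p.
    This is used for unbounded r, where n may be smaller than r and the
    averaged bounds are too weak. *)
Lemma gap_by_tangent q L i (e : bool) p : 0 < q -> 0 < i + L ->
  let n := 2 * i + L + e in let D := i + L - 1 in
  q.+1 * p <= n.-1 <= q.+1 * p.+1 -> 2 * p + 3 <= i + e ->
  join_size q n D + e < turan_size q.+1 n.-1 + L.
Proof.
move=> q_gt0 iL n D hp lt.
have := turan_size_exact hp; have := turan_size_tangent D p q_gt0.
have eN : n.-1 = D + (i + e) by rewrite /n /D; lia.
have eD : n - D = i + e + 1 by rewrite /n /D; lia.
have eL : L + (i + e) = D + 1 + e by rewrite /D; lia.
rewrite /join_size eN eD; move: (turan_size q D) (turan_size q.+1 _) => t u.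
move: lt eL; clear hp eN eD n iL; move: D (i + e) => D j lt eL ht hu.
have [d ed] : exists d, j = d + (2 * p + 3) by exists (j - (2 * p + 3)); lia.
have : 0 <= d * d by []. have : 0 <= d * p by []. have : 0 <= p * p by [].
move: (nat_of_bool e) eL => b eL; subst j; lia.
Qed.

(** For r <= 7 only finitely many values escape the averaged estimate, and
    these are checked by computation. For r >= 8 the threshold gives 4 * p < 2
    * i + e - 4, and for L <= 2 a direct discussion leaves K_{3,1,...,1} and
    one more case. *)
Lemma exceptional_or_gap q L i (e : bool) : 2 <= i ->
  admissible q L (2 * i + L + e) ->
  let n := 2 * i + L + e in let D := i + L - 1 in
  join_size q n D + e < turan_size q.+1 n.-1 + L \/ (e = false /\ exceptional_index q L i).
Proof.
move=> i2 gd n D.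
have iL : 0 < i + L by lia.
have small (b : nat) : q <= 6 -> i <= b -> L <= b -> b <= 8 ->
   join_size q n D + e < turan_size q.+1 n.-1 + L \/ (e = false /\ exceptional_index q L i).
  move=> q6 ib Lb b8.
  have chk : all (fun q => all (fun i => all (fun L => all (fun e : bool =>
     let n := 2 * i + L + e in let D := i + L - 1 in
     (2 <= i) && admissible q L n ==>
       ((join_size q n D + e < turan_size q.+1 n.-1 + L) || (~~ e && exceptional_index q L i)))
       [:: true; false]) (iota 0 9)) (iota 0 9)) (iota 0 7) by vm_compute.
  have mi m k : m <= k -> m \in iota 0 k.+1 by rewrite mem_iota.
  have {}chk := allP chk q (mi _ _ q6).
  have {}chk := allP chk i (mi _ _ (leq_trans ib b8)).
  have {}chk := allP chk L (mi _ _ (leq_trans Lb b8)).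
  have {}chk := allP chk e (ltac:(by case: (e)) : e \in [:: true; false]).
  have /orP[h|/andP[/negbTE h1 h2]] := implyP chk (introT andP (conj i2 gd)); [by left|by right].
case/or4P: gd => /andP[].
- move=> /eqP eq; rewrite eq => le; left; apply: gap_by_average => //; first by lia.
  have [x ex] : exists x, x = 2 * (i + e) - (i + L - 1) by exists (2 * (i + e) - (i + L - 1)).
  rewrite -ex; have : 5 * x >= 3 * (i + e) + 25 by lia.
  move: (i + e) => j lx; nia.
- move=> /eqP eq le; subst q.
  have [j6|j7] := leqP (i + e) 6.
    by apply: (small 8) => //; lia.
  left; apply: gap_by_average => //; first by lia.
  have [x ex] : exists x, x = 3 * (i + e) - (i + L - 1) by exists (3 * (i + e) - (i + L - 1)).
  rewrite -ex; have : 2 * x >= 3 * (i + e) + 5 by lia.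
  move: (i + e) j7 => j j7 lx; nia.
- move=> /andP[q4 q6] le.
  have [j6|j7] := leqP (i + e) 6.
    by apply: (small 8) => //; lia.
  left; apply: gap_by_average => //; [by lia|by nia|].
  have [x ex] : exists x, x = q * (i + e) - (i + L - 1) by exists (q * (i + e) - (i + L - 1)).
  rewrite -ex; have : x >= (q - 2) * (i + e) + 3 by nia.
  have : (q == 4) || (q == 5) || (q == 6) by lia.
  move: (i + e) j7 => j j7 /orP[/orP[]|]/eqP-> lx; nia.
move=> q7 le.
have r_gt0 : 0 < q.+1 by [].
pose p := (n - 2) %/ q.+1.
have hp : q.+1 * p <= n.-1 <= q.+1 * p.+1.
  have := leq_divM (n - 2) q.+1; have := ltn_ceil (n - 2) r_gt0; rewrite -/p.
  by rewrite ![_ * q.+1]mulnC => h1 h2; apply/andP; split; rewrite /n in h1 h2 *; lia.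
have [lt|nlt] := leqP (2 * p + 3) (i + e).
  by left; apply: gap_by_tangent hp lt => //; lia.
have hp2 : q.+1 * p <= n - 2 by rewrite mulnC leq_divM.
case/orP: le => [L2|le4]; last first.
  exfalso; have : 4 * (q.+1 * p) < (n - L - 4) * q.+1.
    by move: hp2 le4 i2; rewrite /n; clear; lia.
  have -> : 4 * (q.+1 * p) = 4 * p * q.+1 by lia.
  rewrite ltn_pmul2r //; by rewrite /n; move: nlt i2; clear; lia.
have p8 : 8 * p <= n - 2 by apply: leq_trans hp2; rewrite leq_mul2r ltnS q7 orbT.
have p1 : p <= 1 by move: p8; rewrite /n; move: nlt L2 i2; clear; lia.
have [p0|pn0] := eqVneq p 0.
  right; have [-> ei] : e = false /\ i = 2.
    by move: nlt i2; rewrite p0; case: (e) => //=; clear; lia.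
  split=> //; rewrite /exceptional_index ei L2 eqxx /=; apply/orP; left.
  by move: q7 L2; clear; lia.
have ep : p = 1 by lia.
rewrite ep in p8 nlt hp2.
have [e0 ei] : e = false /\ i = 4.
  by move: nlt i2 p8 L2; rewrite /n; case: (e) => //=; clear; lia.
have eL : L = 2 by move: p8; rewrite /n e0 ei; move: L2; clear; lia.
have eq : q = 7 by move: hp2; rewrite /n e0 ei eL; move: q7; clear; lia.
by left; rewrite /D /n e0 ei eL eq.
Qed.

Lemma turan_size_complete r m : m <= r -> 2 * turan_size r m + m = m ^ 2.
Proof.
by move=> le; have := @turan_size_exact r m 0; rewrite muln0 muln1 le /= => /(_ isT); lia.
Qed.

Lemma exceptional_tight q L i : exceptional_index q L i ->
  join_size q (2 * i + L) (i + L - 1) = turan_size q.+1 (2 * i + L).-1 + L.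
Proof.
case/orP=> [/andP[/andP[/eqP-> L2] Lq]|].
  rewrite /join_size; have -> : (2 * 2 + L).-1 = L + 3 by lia.
  have -> : 2 + L - 1 = L + 1 by lia.
  have := @turan_size_complete q (L + 1); have := @turan_size_complete q.+1 (L + 3).
  have -> : L + 1 <= q by lia. have -> : L + 3 <= q.+1 by lia.
  have -> : 2 * 2 + L - (L + 1) = 3 by lia.
  move=> /(_ isT) + /(_ isT); case: L L2 {Lq} => [|[|[|//]]] _; lia.
by rewrite !inE => /or4P[|||/or4P[|||/or3P[]]] /eqP[-> -> ->]; vm_compute.
Qed.

Lemma admissible_gap q L n : L + 5 <= n -> admissible q L n ->
  L + 2 < turan_gap q.+1 n.-2 /\ (L + 7 <= n -> L + 3 < turan_gap q.+1 n.-2).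
Proof.
move=> le gd; rewrite /turan_gap; have := leq_divM n.-2 q.+1.
move: (n.-2 %/ q.+1) => p.
case/or4P: gd => /andP[].
- by move=> /eqP->; clear -le; lia.
- by move=> /eqP-> /orP[/eqP->|]; clear -le; lia.
- move=> /andP[q4 _] h hp; have : p * 5 <= p * q.+1 by rewrite leq_mul2l ltnS q4 orbT.
  case/or3P: h => [h|h|/andP[/eqP h q5]]; try by clear q4; lia.
  have : p * 6 <= p * q.+1 by rewrite leq_mul2l ltnS q5 orbT.
  by subst L; clear q4; lia.
move=> q7 /orP[h|h] hp.
  have : p * 8 <= p * q.+1 by rewrite leq_mul2l ltnS q7 orbT.
  by lia.
have : 4 * p < n - L - 4.
  by rewrite -(ltn_pmul2r (ltn0Sn q)); move: hp h le; clear; lia.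
by move: le; clear; lia.
Qed.

Lemma admissible_tame q L n : L + 4 <= n -> admissible q L n -> tame q L n.
Proof.
move=> le gd; rewrite /tame; set i := (n - L)./2; set D := i + L - 1.
have en : n = 2 * i + L + odd (n - L).
  by have := odd_double_half (n - L); rewrite -/i -addnn; move: (odd _) => b; lia.
have i2 : 2 <= i by move: en; case: (odd _) => /=; lia.
have b1 := leq_b1 (odd (n - L)).
split.
- have gd' := gd; rewrite /D; move: en b1; move: (nat_of_bool _) => b en b1; clearbody i.
  clear D; case/or4P: gd' => /andP[].
  + by move=> /eqP-> h; lia.
  + by move=> /eqP-> /orP[/eqP->|h]; lia.
  + move=> /andP[q4 _] h; have : 4 * i <= q * i by rewrite leq_mul2r q4 orbT.
    by case/or3P: h => [h|h|/andP[/eqP h _]]; lia.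
  move=> q7 /orP[h|h].
    have : 7 * i <= q * i by rewrite leq_mul2r q7 orbT.
    by lia.
  have : (n - L - 4) * q.+1 <= (2 * i - 3) * q.+1 by rewrite leq_mul2r; lia.
  have [j ej] : exists j, i = j.+2 by exists (i - 2); lia.
  by move: h; rewrite en ej; clear; nia.
- have gd' := gd; rewrite en in gd'; have := exceptional_or_gap i2 gd'.
  rewrite -en => -[/ltnW //|[e0 /exceptional_tight]].
  by rewrite e0 addn0 in en *; rewrite -en -/D addn0 => ->.
- by move=> h; case: (@admissible_gap q L n h gd).
move=> h; have h5 : L + 5 <= n by move: h; clear; lia.
by case: (@admissible_gap q L n h5 gd) => _; apply.
Qed.

(** * Vertex deletion, separations and constructions *)

Lemma witness_extremal (G : sgraph) (r L n : nat) : 2 <= r -> 0 < n -> #|G| = n ->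
  clique_free G r.+1 -> admissible r.-1 L n -> chvatal_witness L (@sedge G) ->
  num_edges G <= turan_size r n.-1 + L /\
  (num_edges G = turan_size r n.-1 + L ->
     calG (L%:Z - 1)%R n r G \/
     exists i, [/\ 2 <= i, n = 2 * i + L, exceptional_index r.-1 L i &
       exists2 c, multipartite_on [set: G] r c &
         perm_eq (part_sizes [set: G] r c) (i.+1 :: turan_parts r.-1 (i + L - 1))]).
Proof.
case: r => // q; rewrite ltnS => q_gt0 n_gt0 eG cf gd; have cb := clique_freeP cf.
case=> [[v dv]|[i [A [M [i2 le_n [cA degA] [cM degM]]]]]].
  split; last first.
    move=> e; left; have ge : turan_size q.+1 #|G|.-1 + L <= num_edges G by rewrite eG e.
    by rewrite -eG; exact: small_degree_eq (ltn0Sn q) cf dv ge.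
  have := small_degree_bound v (ltn0Sn q) cb; rewrite eG => le.
  by apply: leq_trans le _; rewrite leq_add2l.
rewrite -eG in le_n cM degM n_gt0 gd *.
have tm : tame q L #|G| by apply: admissible_tame gd; move: le_n i2; clear; lia.
have [le ext] := many_low_degrees q_gt0 cb i2 le_n cA degA cM degM tm.
split=> // /ext [i2' en tight [c mc pc]]; right; exists (#|G| - L)./2; split=> //; last by exists c.
have := @exceptional_or_gap q L (#|G| - L)./2 false i2'.
rewrite /= !addn0 -en => /(_ gd) [lt|[]] //.
by move: lt; rewrite tight ltnn.
Qed.

Lemma degree_del_le (G : sgraph) (S : {set G}) (x : del_vertices S) :
  degree (val x) <= degree x + #|S|.
Proof. by rewrite degree_del (degree_split S) addnC leq_add2l degree_in_le. Qed.

(** Deleting S lowers degrees by at most #|S|, so the degree condition for L in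
    the smaller graph gives the one for L + #|S|. The k-versions of the
    properties are reduced to the plain ones in this way. *)
Lemma witness_del (G : sgraph) (S : {set G}) L :
  chvatal_witness L (@sedge (del_vertices S)) -> chvatal_witness (L + #|S|) (@sedge G).
Proof.
have cS : #|S| + #|del_vertices S| = #|G| by rewrite card_sub_set cardsC.
have dle (x : del_vertices S) : degree (val x) <= degree x + #|S| := degree_del_le x.
case=> [[v dv]|[i [A [M [i2 le_n [cA degA] [cM degM]]]]]].
  by left; exists (val v); apply: leq_trans (dle v) _; rewrite leq_add2r.
right; exists i, [set val x | x in A], [set val x | x in M].
rewrite !(card_imset _ val_inj); split=> //.
- by rewrite -cS addnA [leqRHS]addnC leq_add2r; exact: le_n.
- split=> // _ /imsetP[x xA ->]; apply: leq_ltn_trans (dle x) _.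
  by rewrite addnA ltn_add2r; exact: degA.
split; first by rewrite -cS addnA [ltnRHS]addnC ltn_add2l; exact: cM.
move=> _ /imsetP[x xM ->]; apply: leq_ltn_trans (leq_add (dle x) (leqnn i)) _.
by rewrite -addnA [#|S| + i]addnC addnA -cS [#|S| + _]addnC ltn_add2r; exact: degM.
Qed.

(** Added one vertex at a time, the vertices of T_r(a + 1 + m) beyond the first
    a + 1 gain at least a - u more edges than the corresponding vertices of
    T_r(m + 1), where u is an upper bound for a / r. *)
Lemma turan_size_superadd r a u c m : 0 < r -> a <= r * u -> c + 1 + u <= a ->
  turan_size r a.+1 + turan_size r m.+1 + m * (c + 1) <= turan_size r (a.+1 + m).
Proof.
move=> r_gt0 leu lec; elim: m => [|m IH].
  by rewrite mul0n !addn0.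
have -> : a.+1 + m.+1 = (a.+1 + m).+1 by rewrite addnS.
have -> : turan_size r (a.+1 + m).+1 = turan_size r (a.+1 + m) + (a.+1 + m - (a.+1 + m) %/ r) by [].
have -> : turan_size r m.+2 = turan_size r m.+1 + (m.+1 - m.+1 %/ r) by [].
rewrite mulSn.
have : (a.+1 + m) %/ r <= m.+1 %/ r + u.
  rewrite addSnnS addnC -divnDMl // leq_div2r // leq_add2l.
  by rewrite mulnC.
have : m.+1 %/ r <= m.+1 := leq_div _ _.
move: (m.+1 %/ r) ((a.+1 + m) %/ r) => x y; move: IH lec; clear; lia.
Qed.

(** The edges meeting X lie inside X or join X to S. *)
Lemma separated_bound (G : sgraph) r (X S Y : {set G}) i c : 0 < r ->
  clique_bounded [set: G] r -> #|X| = i -> #|S| = c -> [disjoint X & S] ->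
  Y = ~: (X :|: S) -> {in X & Y, forall x y, ~~ x -- y} ->
  num_edges G <= turan_size r (#|G| - i) + turan_size r i + i * c.
Proof.
move=> r_gt0 cb cX cS dXS eY nXY; have e := degree_sum_setT X.
have b1 := turan_bound r_gt0 (clique_bounded_sub (subsetT X) cb).
have b2 := turan_bound r_gt0 (clique_bounded_sub (subsetT (~: X)) cb).
have cC : #|~: X| = #|G| - i by rewrite -cX -(cardsC X) addKn.
have : \sum_(x in X) degree x <= degree_sum X + i * c.
  rewrite /degree_sum -cX -sum_nat_const -big_split /= leq_sum // => x xX.
  rewrite (degree_split X) leq_add2l -cS; apply: subset_leq_card; apply/subsetP => y.
  rewrite !inE => /andP[yX xy]; apply: contraT => yS.
  have yY : y \in Y by rewrite eY !inE negb_or yX.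
  by have := nXY x y xX yY; rewrite xy.
by rewrite cX in b1; rewrite cC in b2; move: e b1 b2; clear; lia.
Qed.

(** The component of a vertex and the rest of the graph, the smaller one being
    called X. *)
Lemma separation (G : sgraph) (S : {set G}) : ~ connected (del_vertices S) ->
  exists X Y : {set G}, [/\ [disjoint X & S], Y = ~: (X :|: S),
    {in X & Y, forall x y, ~~ x -- y} & 0 < #|X| <= #|Y|].
Proof.
move=> nc; have [x [y nxy]] : exists x y, ~~ connect (@sedge (del_vertices S)) x y.
  apply: NNPP => h; apply: nc => x y; apply: contraT => nxy; exfalso; apply: h.
  by exists x, y.
pose C := [set z | connect (@sedge (del_vertices S)) x z].
pose X := [set val z | z in C]; pose Y := [set val z | z in ~: C].
have dXS (D : {set del_vertices S}) : [disjoint [set val z | z in D] & S].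
  by apply/pred0P => z /=; apply/negP => /andP[/imsetP[[u uS] _ ->]]; apply/negP.
have eY (D : {set del_vertices S}) :
    [set val z | z in ~: D] = ~: ([set val z | z in D] :|: S).
  apply/setP => z; rewrite !inE; have [zS|zS] := boolP (z \in S).
    rewrite orbT; apply/negP => /imsetP[[u uS] _ eu].
    by move: zS; rewrite eu /= (negPf uS).
  have -> : z = val (exist _ z zS : del_vertices S) by [].
  by rewrite orbF !(mem_imset _ _ val_inj) inE.
have nXY : {in X & Y, forall u v, ~~ u -- v}.
  move=> _ _ /imsetP[u uC ->] /imsetP[v vC ->]; apply/negP => uv.
  move: uC vC; rewrite !inE => xu /negP; apply; apply: connect_trans xu _.
  exact: connect1.
have X0 : 0 < #|X| by apply/card_gt0P; exists (val x); apply: imset_f; rewrite inE connect0.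
have Y0 : 0 < #|Y| by apply/card_gt0P; exists (val y); apply: imset_f; rewrite in_setC /C inE.
have [le|/ltnW le] := leqP #|X| #|Y|; first by
  exists X, Y; rewrite X0; split=> //; [exact: dXS|exact: eY].
exists Y, X; rewrite Y0; split=> //; first exact: dXS.
  by rewrite -eY setCK.
by move=> u v uY vX; rewrite sedge_sym nXY.
Qed.

(** The thresholds of the part on connectivity, with c = k - 1. *)
Definition admissible_connectivity (r c n : nat) :=
  [|| (r == 3) && (6 * c + 20 <= n), (4 <= r <= 7) && (5 * c + 6 <= n) |
      (8 <= r) && (2 * c + 7 <= n)].

(** If X is a single vertex, its neighbours lie in S. Otherwise the bound T_r(n
    - i) + T_r(i) + i * #|S| is strictly smaller by superadditivity. *)
Lemma disconnected_extremal (G : sgraph) (r L n : nat) (S : {set G}) :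
  2 <= r -> #|G| = n -> clique_free G r.+1 -> admissible_connectivity r L n -> #|S| <= L ->
  ~ connected (del_vertices S) ->
  num_edges G <= turan_size r n.-1 + L /\
  (num_edges G = turan_size r n.-1 + L -> calG (L%:Z - 1)%R n r G).
Proof.
move=> r2 eG cf gd leS /separation[X [Y [dXS eY nXY /andP[X0 leXY]]]].
have cb := clique_freeP cf; have r_gt0 : 0 < r := ltnW r2.
have cXY : #|X| + #|S| + #|Y| = n.
  have := leq_card_setU X S; rewrite dXS => -[_ /eqP <-].
  by rewrite eY cardsC.
have [X1|X2] := leqP #|X| 1.
  have /cards1P[v eX] : #|X| == 1 by rewrite eqn_leq X1 X0.
  have dv : degree v <= L.
    apply: leq_trans leS; apply: subset_leq_card; apply/subsetP => y; rewrite inE => vy.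
    apply: contraT => yS; have := nXY v y; rewrite eX eY !inE eqxx vy eX inE negb_or yS andbT.
    move=> /(_ isT); apply; apply: contraTneq vy => ->; by rewrite sedge_irrefl.
  split; last first.
    move=> e; have ge : turan_size r #|G|.-1 + L <= num_edges G by rewrite eG e.
    by rewrite -eG; exact: small_degree_eq r_gt0 cf dv ge.
  have := small_degree_bound v r_gt0 cb; rewrite eG => le.
  by apply: leq_trans le _; rewrite leq_add2l.
suff : num_edges G < turan_size r n.-1 + L by clear; lia.
have b := separated_bound r_gt0 cb erefl erefl dXS eY nXY; rewrite eG in b.
move: b cXY leXY X2 leS; move: #|X| #|S| #|Y| (num_edges G) => i c j e b en le_ij i2 le_cL.
pose a := n - i - 1.
have [u leu lec] : exists2 u, a <= r * u & c + 1 + u <= a.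
  rewrite /a; case/or3P: gd => /andP[].
  - move=> /eqP-> le; exists ((n - i - 1 + 2) %/ 3); move: en le le_ij i2 le_cL; clear; lia.
  - move=> /andP[r4 _] le; exists ((n - i - 1 + 3) %/ 4).
      by apply: leq_trans (leq_mul r4 (leqnn _)); clear; lia.
    move: en le le_ij i2 le_cL; clear; lia.
  move=> r8 le; exists ((n - i - 1 + 7) %/ 8).
    by apply: leq_trans (leq_mul r8 (leqnn _)); clear; lia.
  move: en le le_ij i2 le_cL; clear; lia.
have := turan_size_superadd i.-1 r_gt0 leu lec.
have -> : a.+1 + i.-1 = n.-1 by move: en le_ij i2; rewrite /a; clear; lia.
have -> : a.+1 = n - i by move: en le_ij i2; rewrite /a; clear; lia.
have -> : i.-1.+1 = i by move: i2; clear; lia.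
move: b i2 le_cL; move: (turan_size r (n - i)) (turan_size r i) (turan_size r _) => x y z.
case: i {a le_ij en leu lec} => // i; rewrite /=; clear; lia.
Qed.

Section Pendant.
Variables (G : sgraph) (W : {set G}).

Definition pendant := SGraph (cone_sym W (@sedge_sym G)) (cone_irrefl W (@sedge_irrefl G)).

Lemma pendant_degree : degree (None : pendant) = #|W|.
Proof.
have someI : injective (@Some G) by move=> x y [].
rewrite /degree -(card_imset _ someI); apply: eq_card => -[x|].
  by rewrite (mem_imset _ _ someI) inE.
by rewrite inE /=; apply/esym/imsetP => -[].
Qed.

Lemma pendant_del : isomorphic (del_vertices [set (None : pendant)]) G.
Proof.
pose f (x : del_vertices [set (None : pendant)]) : option G := val x.
have fS (x : del_vertices [set (None : pendant)]) : exists y, f x == Some y.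
  case: x => -[y|] h; first by exists y; rewrite /f /=.
  by exfalso; have := h; rewrite inE eqxx.
exists (fun x => xchoose (fS x)); last first.
  move=> x y; have := xchooseP (fS x); have := xchooseP (fS y).
  move: (xchoose _) (xchoose _) => a b /eqP ey /eqP ex.
  by rewrite -[RHS]/(cone W sedge (f x) (f y)) ex ey.
have nN (y : G) : (Some y : pendant) \notin [set (None : pendant)] by rewrite inE.
exists (fun y => exist _ (Some y : pendant) (nN y)).
  move=> x; apply: val_inj => /=; have /eqP <- := xchooseP (fS x); done.
move=> y; have /eqP := xchooseP (fS (exist _ (Some y : pendant) (nN y))).
by rewrite {1}/f /= => -[].
Qed.

(** The new vertex receives a colour that does not occur on W, so the new graph
    is r-colourable. *)
Lemma pendant_clique_free r (c : G -> nat) j : (forall x, c x < r) -> j < r ->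
  (forall x y, x -- y -> c x != c y) -> {in W, forall x, c x != j} ->
  clique_free pendant r.+1.
Proof.
move=> cr ltj cE cW A cA cardA.
pose d (x : pendant) : 'I_r := if x is Some y then Ordinal (cr y) else Ordinal ltj.
have : #|d @: A| <= r by rewrite -[leqRHS]card_ord max_card.
rewrite card_in_imset ?cardA ?ltnn // => x y xA yA e; apply/eqP/negPn/negP => nxy.
have := cA x y xA yA nxy; move/(congr1 val): e; rewrite /d.
case: x y {xA yA nxy} => [x|] [y|] //=.
- by move=> e /cE; rewrite e eqxx.
- by move=> e /cW; rewrite e eqxx.
by move=> e /cW; rewrite e eqxx.
Qed.
End Pendant.

(** The new vertex is joined to L vertices outside the residue class r - 1,
    which is a smallest part of T_r(n - 1). *)
Lemma exists_calG (L n r : nat) : 0 < r -> 0 < n -> L + n.-1 %/ r <= n.-1 ->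
  exists G, calG (L%:Z - 1)%R n r G.
Proof.
move=> r_gt0 n_gt0 le; pose T := turan r n.-1; pose c (x : T) := (x : 'I_n.-1) %% r.
have [W sW cW] : exists2 W : {set T}, W \subset ~: [set x | c x == r.-1] & #|W| = L.
  have : L <= #|~: [set x : T | c x == r.-1]|.
    rewrite -(leq_add2l #|[set x : T | c x == r.-1]|) cardsC.
    have -> : #|[set x : T | c x == r.-1]| = n.-1 %/ r.
      have ltr : r.-1 < r by rewrite prednK.
      have := count_residue n.-1 ltr; rewrite prednK // subnn addn0 => <-.
      rewrite -sum1_card big_mkcond /=; apply: eq_bigr => x _.
      by rewrite inE /c; case: (_ == _).
    by rewrite card_ord addnC.
  by case/subset_of_card => W sW cW; exists W.
exists (pendant W); split.
- by rewrite card_option card_ord prednK.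
- apply: (@pendant_clique_free T W r c r.-1) => [x||x y|x xW] //.
  + exact: ltn_pmod.
  + by rewrite prednK.
  by have := subsetP sW x xW; rewrite !inE.
exists None; split; first exact: pendant_del.
by rewrite pendant_degree cW; lia.
Qed.

Lemma calG_num_edges (L n r : nat) G : calG (L%:Z - 1)%R n r G ->
  num_edges G = num_edges (turan r n.-1) + L.
Proof.
case=> _ _ [v [iso dv]]; rewrite (num_edges_del1 v) (iso_num_edges iso); congr (_ + _).
lia.
Qed.

Lemma calG_degree (L n r : nat) G : calG (L%:Z - 1)%R n r G -> exists v : G, degree v = L.
Proof. by case=> _ _ [v [_ dv]]; exists v; lia. Qed.

Lemma not_traceable_isolated (G : sgraph) (v : G) : 1 < #|G| -> degree v = 0 -> ~ traceable G.
Proof.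
move=> G1 dv [x [p [pp up fp]]].
have nv y : ~~ (v -- y).
  by apply/negP => vy; move/eqP: dv; rewrite cards_eq0 => /eqP/setP/(_ y); rewrite !inE vy.
have sz : size (x :: p) = #|G|.
  by have <- := card_uniqP up; apply: eq_card => z; rewrite fp.
have := fp v; rewrite inE => /predU1P[e|vp].
  case: p pp up fp sz => [|y p] /=; first by move=> _ _ _ e1; rewrite -e1 in G1.
  by rewrite -e (negPf (nv y)).
move: pp; case/splitPr: vp => p1 p2; rewrite cat_path /= => /and3P[_ h _].
by move: h; rewrite sedge_sym (negPf (nv _)).
Qed.

(** The two neighbours of v on the cycle are distinct since the cycle has at
    least three vertices. *)
Lemma hamiltonian_degree (G : sgraph) (v : G) : hamiltonian G -> 2 <= degree v.
Proof.
case=> c [cc uc sc fc].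
have [i p ec] := rot_to (fc v).
have up : uniq (v :: p) by rewrite -ec rot_uniq.
have cp : cycle sedge (v :: p) by rewrite -ec rot_cycle.
have sp : 2 < size (v :: p) by rewrite -ec size_rot.
case: p up cp sp {ec} => // a p; case/lastP: p => // p b up.
rewrite /= rcons_path last_rcons => /and3P[va _ bv] _.
apply: leq_trans (_ : #|[set a; b]| <= _).
  move: up; rewrite cards2 /= mem_rcons inE => /and3P[_ /norP[-> _] _] //.
apply: subset_leq_card; apply/subsetP => z; rewrite !inE => /orP[]/eqP-> //.
by rewrite sedge_sym.
Qed.

(** If v had exactly two neighbours x and y, a Hamiltonian path from x to y
    would have to be x, v, y. *)
Lemma ham_connected_degree (G : sgraph) (v : G) : ham_connected G -> 3 < #|G| ->
  degree v <> 2.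
Proof.
move=> hc G4 /eqP/cards2P[x [y [nxy /setP eN]]].
have vx : v -- x by have := eN x; rewrite !inE eqxx.
have vy : v -- y by have := eN y; rewrite !inE eqxx orbT.
have nb z : v -- z -> z = x \/ z = y.
  by move=> vz; have := eN z; rewrite !inE vz => /esym/orP[]/eqP; [left|right].
have nvx : v != x by apply: contraTneq vx => ->; rewrite sedge_irrefl.
have nvy : v != y by apply: contraTneq vy => ->; rewrite sedge_irrefl.
have [p [[pp up fp] lp]] := hc x y nxy.
have sz : size (x :: p) = #|G|.
  by have <- := card_uniqP up; apply: eq_card => z; rewrite fp.
have vp : v \in p by have := fp v; rewrite inE (negPf nvx).
move: pp up lp sz {fp}; case/splitPr: vp => p1 p2.
rewrite cat_path last_cat /= => /and3P[_ e1 e2] up lp.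
case: p2 e2 up lp => [|b p2] /= e2 up lp; first by rewrite lp eqxx in nvy.
case/andP: e2 => vb _; rewrite sedge_sym in e1.
have {}up : uniq ((x :: p1) ++ v :: b :: p2) := up.
rewrite cat_uniq in up; case/and3P: up => up1 /hasPn dis /and3P[_ bp2 up2].
have yb : y \in b :: p2 by rewrite -lp mem_last.
have yv : y \in v :: b :: p2 by rewrite inE yb orbT.
have bx : b != x.
  by apply: contraNneq (dis b _) => [->|]; rewrite !inE eqxx ?orbT.
have p1x : last x p1 = x.
  case: (nb _ e1) => // ey; have := dis y yv.
  by rewrite /= -ey mem_last.
have p1E : p1 = [::].
  case/lastP: p1 up1 p1x {e1 dis} => // q z; rewrite last_rcons => + ezx.
  by rewrite ezx /= mem_rcons mem_head.
have by_ : b = y by case: (nb _ vb) => // ebx; rewrite ebx eqxx in bx.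
have p2E : p2 = [::].
  case/lastP: p2 bp2 lp {up2 yb yv dis} => // q z; rewrite last_rcons => + ezy.
  by rewrite ezy by_ mem_rcons mem_head.
by rewrite p1E p2E /= => e; rewrite -e in G4.
Qed.

(** Used to lower the degree of one vertex to 1, 2 or 0, which destroys
    Hamiltonicity, Hamiltonian-connectedness or connectedness. *)
Lemma delete_neighbours (G : sgraph) (v : G) k : k <= degree v ->
  exists (S : {set G}) (w : del_vertices S), #|S| = k /\ degree w = degree v - k.
Proof.
case/subset_of_card => S sS cS; have vS : v \notin S.
  by apply/negP => /(subsetP sS); rewrite inE sedge_irrefl.
exists S, (exist _ v vS); split=> //.
rewrite degree_del /= (degree_split S v).
have -> : degree_in S v = k.
  rewrite -cS; apply: eq_card => y; rewrite inE; case: (boolP (y \in S)) => // /(subsetP sS).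
  by rewrite inE.
by rewrite addKn.
Qed.

Lemma not_k_hamiltonian (G : sgraph) (v : G) k : degree v = k + 1 -> ~ k_hamiltonian k G.
Proof.
move=> dv hk; have [|S [w [cS dw]]] := @delete_neighbours G v k; first by rewrite dv leq_addr.
have leS : #|S| <= k by rewrite cS.
by have := hamiltonian_degree w (hk S leS); rewrite dw dv addKn.
Qed.

Lemma not_k_ham_connected (G : sgraph) (v : G) k : 0 < k -> k + 3 <= #|G| ->
  degree v = k + 1 -> ~ k_ham_connected k G.
Proof.
move=> k0 Gk dv hk; have [|S [w [cS dw]]] := @delete_neighbours G v k.-1.
  by rewrite dv; move: k0; clear; lia.
have leS : #|S| < k by rewrite cS prednK.
apply: (ham_connected_degree (v := w) (hk S leS)).
  rewrite card_sub_set -(ltn_add2l #|S|) cardsC cS; move: Gk k0; clear; lia.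
by rewrite dw dv; move: k0; clear; lia.
Qed.

Lemma not_k_connected (G : sgraph) (v : G) k : 0 < k -> k + 1 <= #|G| ->
  degree v = k - 1 -> ~ k_connected k G.
Proof.
move=> k0 Gk dv hk; have [|S [w [cS dw]]] := @delete_neighbours G v (k - 1).
  by rewrite dv.
have leS : #|S| < k by rewrite cS; move: k0; clear; lia.
have cn := hk S leS; rewrite dv subnn in dw.
have /card_gt1P[a [b [_ _ nab]]] : 1 < #|del_vertices S|.
  by rewrite card_sub_set -(ltn_add2l #|S|) cardsC cS; move: Gk k0; clear; lia.
have [u nuw] : exists u, u != w.
  by have [eaw|naw] := eqVneq a w; [exists b; rewrite -eaw eq_sym|exists a].
case/connectP: (cn w u) => -[|z p] /=; first by move=> _ e; rewrite e eqxx in nuw.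
case/andP=> wz _ _; have {}wz : w -- z := wz; move/eqP: dw; rewrite cards_eq0 => /eqP/setP/(_ z).
by rewrite in_set0 in_set wz.
Qed.

(** * The six parts of the theorem *)

(** A vertex of degree L can avoid the smallest part of T_r(n - 1). *)
Lemma admissible_feasible (r L n : nat) : 0 < r -> L < n -> admissible r.-1 L n ->
  L + n.-1 %/ r <= n.-1.
Proof.
case: r => // q _ lt; rewrite [q.+1.-1]/=; have := leq_divM n.-1 q.+1.
move: (n.-1 %/ q.+1) => p hp; case/or4P => /andP[].
- by move=> /eqP e; move: hp; rewrite e; clear -lt; lia.
- by move=> /eqP e; move: hp; rewrite e; clear -lt; lia.
- move=> /andP[q4 _] h; have le5 : p * 5 <= p * q.+1 by rewrite leq_mul2l ltnS q4 orbT.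
  by case/or3P: h => [h|h|/andP[/eqP h _]]; move: hp lt h le5; clear; lia.
move=> q7 /orP[h|h].
  have : p * 8 <= p * q.+1 by rewrite leq_mul2l ltnS q7 orbT.
  by move: hp lt h; clear; lia.
have [p0|p0] := posnP p; first by move: lt; rewrite p0; clear; lia.
have : 4 * p <= n - L - 4.
  by rewrite -(leq_pmul2r (ltn0Sn q)); move: hp h; clear; lia.
by move: p0; clear; lia.
Qed.

Lemma admissible_connectivity_feasible (r L n : nat) : admissible_connectivity r L n ->
  L + n.-1 %/ r <= n.-1.
Proof.
move=> gd; have := leq_divM n.-1 r; move: (n.-1 %/ r) => p hp.
case/or3P: gd => /andP[].
- by move=> /eqP e; move: hp; rewrite e; clear; lia.
- move=> /andP[r4 _]; have : p * 4 <= p * r by rewrite leq_mul2l r4 orbT.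
  by move: hp; clear; lia.
move=> r8; have : p * 8 <= p * r by rewrite leq_mul2l r8 orbT.
by move: hp; clear; lia.
Qed.

Lemma iso_parts_edges (G : sgraph) a t : isomorphic G (complete_multipartite a) ->
  2 * t + sumsq a = sumn a ^ 2 -> num_edges G = t.
Proof.
by move=> /iso_num_edges-> e; have := complete_multipartite_num_edges a; lia.
Qed.

Lemma extremal_iso (G : sgraph) r L i c a : multipartite_on [set: G] r c ->
  perm_eq (part_sizes [set: G] r c) (i.+1 :: turan_parts r.-1 (i + L - 1)) ->
  size a <= r ->
  perm_eq (i.+1 :: turan_parts r.-1 (i + L - 1)) (a ++ nseq (r - size a) 0) ->
  isomorphic G (complete_multipartite a).
Proof. by move=> mc p1 le p2; apply: (iso_complete_multipartite le mc (perm_trans p1 p2)). Qed.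

(** The parts of K_{3,1,...,1} with L + 1 singletons. *)
Lemma triple_parts q L : L + 3 <= q ->
  perm_eq (3 :: turan_parts q (L + 1)) ((3 :: nseq (L + 1) 1) ++ nseq (q.+1 - (L + 1).+1) 0).
Proof.
move=> le; have lt : L + 1 < q by move: le; clear; lia.
by rewrite /turan_parts modn_small // divn_small // perm_cons subSS perm_catC.
Qed.

Lemma triple_iso (G : sgraph) r L c : 0 < r -> L + 3 <= r.-1 ->
  multipartite_on [set: G] r c ->
  perm_eq (part_sizes [set: G] r c) (3 :: turan_parts r.-1 (2 + L - 1)) ->
  isomorphic G (complete_multipartite (3 :: nseq (L + 1) 1)).
Proof.
move=> r_gt0 le mc pc; apply: (extremal_iso mc pc).
  by rewrite /= size_nseq; move: le; clear; lia.
have -> : 2 + L - 1 = L + 1 by clear; lia.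
have := triple_parts le; rewrite prednK //.
by rewrite [size (_ :: _)]/= size_nseq.
Qed.

Lemma sporadic_iso (G : sgraph) r L i n c s j a : 0 < r -> n = 2 * i + L ->
  multipartite_on [set: G] r c ->
  perm_eq (part_sizes [set: G] r c) (i.+1 :: turan_parts r.-1 (i + L - 1)) ->
  0 < s -> r.-1 = s.-1 -> i = j -> size a <= s ->
  perm_eq (j.+1 :: turan_parts s.-1 (j + L - 1)) (a ++ nseq (s - size a) 0) ->
  [/\ r = s, n = 2 * j + L & isomorphic G (complete_multipartite a)].
Proof.
move=> r_gt0 en mc pc s_gt0 e ei le pe.
have er : r = s by rewrite -(prednK r_gt0) e prednK.
by subst r j; split=> //; apply: extremal_iso mc pc le pe.
Qed.

Lemma triple_edges r L : L <= 2 -> L + 3 <= r ->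
  2 * (turan_size r (L + 3) + L) + sumsq (3 :: nseq (L + 1) 1) = sumn (3 :: nseq (L + 1) 1) ^ 2.
Proof.
move=> L2 /turan_size_complete; move: (turan_size _ _) => t.
by case: L L2 => [|[|[|//]]] _; rewrite /sumsq /=; lia.
Qed.

(** The assumption k + 5 < n excludes K_{3,1,...,1}; of the sporadic graphs
    those with L >= 1 remain. *)
Lemma exceptional_Hhat (G : sgraph) (r k n i : nat) c : 0 < r -> k + 5 < n ->
  n = 2 * i + (k + 1) -> exceptional_index r.-1 (k + 1) i ->
  multipartite_on [set: G] r c ->
  perm_eq (part_sizes [set: G] r c) (i.+1 :: turan_parts r.-1 (i + (k + 1) - 1)) ->
  calHhat k%:Z n r G.
Proof.
move=> r0 lt en /orP[/andP[/andP[/eqP ei _] _]|ex] mc pc.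
  by move: lt; rewrite en ei; clear; lia.
have key a : size a <= r -> ((k%:Z)%R, a, r, n) \in exceptional ->
    perm_eq (i.+1 :: turan_parts r.-1 (i + (k + 1) - 1)) (a ++ nseq (r - size a) 0) ->
    calHhat k%:Z n r G.
  by move=> le ina p2; exists a; split=> //; apply: extremal_iso mc pc le p2.
move: ex en key; rewrite !inE !xpair_eqE addn1.
case: r r0 {mc pc} => // q _; rewrite [q.+1.-1]/= => ex en key.
by move: ex; do 8?[case/orP]; case/andP=> /andP[/eqP eq /eqP[ek]] /eqP ei;
  move: key; rewrite en eq ek ei => key //;
  [apply: (key [:: 4; 1; 1; 1])|apply: (key [:: 5; 1; 1; 1; 1])|apply: (key [:: 6; 2; 2; 1])
  |apply: (key [:: 4; 1; 1; 1; 1])|apply: (key [:: 5; 1; 1; 1; 1; 1])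
  |apply: (key [:: 5; 2; 1; 1; 1])|apply: (key [:: 6; 2; 2; 2; 1])].
Qed.


(** Checked on the whole list of exceptional graphs. *)
Lemma Hhat_edges (G : sgraph) (r k n : nat) : calHhat k%:Z n r G ->
  num_edges G = turan_size r n.-1 + (k + 1).
Proof.
case=> a [ina iso]; apply: iso_parts_edges iso _.
have /allP/(_ _ ina) : all (fun t : int * seq nat * nat * nat => let: (l, a, r, n) := t in
   2 * (turan_size r n.-1 + absz (l + 1)%R) + sumsq a == sumn a ^ 2) exceptional.
  by vm_compute.
move/eqP => <-; congr (2 * (_ + _) + _); lia.
Qed.

Section RationalThreshold.
Import Order.TTheory GRing.Theory Num.Theory.

Lemma rat_threshold (r k n : nat) : 8 <= r ->
  (k%:R + 5%:R + 4%:R * (k%:R + 4%:R) / (r%:R - 4%:R) <= n%:R :> rat)%R ->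
  (k + 5) * (r - 4) + 4 * (k + 4) <= n * (r - 4).
Proof.
move=> r8; have [m [m0 ->]] : exists m, 0 < m /\ r = m + 4 by exists (r - 4); move: r8; clear; lia.
rewrite addnK natrD addrK -lerBrDl.
have m0' : (0 < m%:R :> rat)%R by rewrite ltr0n.
rewrite ler_pdivrMr // => h; rewrite -(ler_nat rat) natrD !natrM !natrD.
by move: h; move: (k%:R)%R (m%:R)%R (n%:R)%R => x y z; lra.
Qed.

End RationalThreshold.

Lemma admissible_k_hamiltonian (r k n L : nat) : 3 <= r -> (r = 3 -> 6 * k + 26 <= n) ->
  (4 <= r <= 7 -> 5 * k + 11 <= n) ->
  (8 <= r -> (k + 5) * (r - 4) + 4 * (k + 4) <= n * (r - 4)) ->
  1 <= L <= k + 1 -> admissible r.-1 L n /\ k + 5 < n.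
Proof.
move=> r3 h3 h4 h8 /andP[L1 Lk].
have [e3|n3] := eqVneq r 3.
  have := h3 e3; rewrite /admissible e3 /=; move: Lk; clear; split; last by lia.
  by apply/orP; left; lia.
have [r7|r8] := leqP r 7.
  have /h4 le : 4 <= r <= 7 by rewrite r7 andbT; move: r3 n3; clear; lia.
  split; last by move: le; clear; lia.
  rewrite /admissible; have [e4|n4] := eqVneq r 4.
    by rewrite e4 /=; apply/orP; left; apply/orP; right; move: le Lk; clear; lia.
  have -> : (4 <= r.-1 <= 6) by move: r3 n3 n4 r7; clear; lia.
  have -> : 3 * L + 4 <= n by move: le Lk; clear; lia.
  by rewrite !orbT.
have {h8} := h8 r8; have [m er] : exists m, r = m + 4 by exists (r - 4); move: r8; clear; lia.
have m4 : 4 <= m by move: r8; rewrite er; clear; lia.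
have -> : r - 4 = m by rewrite er addnK.
move=> le; have ltn : k + 5 < n.
  rewrite -(ltn_pmul2r (ltnW (ltnW (ltnW m4)))); move: le; clear; lia.
split=> //; rewrite /admissible; have [t et] : exists t, n = k + 5 + t by exists (n - (k + 5)); lia.
have -> : 4 * n.-1 <= (n - L - 4) * r.-1.+1.
  have -> : r.-1.+1 = m + 4 by rewrite er addn4.
  apply: (@leq_trans (t * (m + 4))); last by rewrite leq_mul2r et; move: Lk; clear; lia.
  by move: le; rewrite et; clear; lia.
have -> : 7 <= r.-1 by move: r8; clear; lia.
by rewrite !orbT.
Qed.

Lemma admissible_k_ham_connected (r k n L : nat) : 3 <= r -> (r = 3 -> 6 * k + 26 <= n) ->
  (r = 4 -> 5 * k + 11 <= n) -> (5 <= r <= 7 -> 3 * k + 7 <= n) ->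
  (8 <= r -> (k + 5) * (r - 4) + 4 * (k + 4) <= n * (r - 4)) ->
  0 < k -> 2 <= L <= k + 1 -> admissible r.-1 L n /\ k + 5 < n.
Proof.
move=> r3 h3 h4 h5 h8 k0 /andP[L2 Lk].
have [/andP[r5 r7]|] := boolP (5 <= r <= 7).
  have /h5 le : 5 <= r <= 7 by rewrite r5.
  split; last by move: le k0; clear; lia.
  rewrite /admissible; have -> : (4 <= r.-1 <= 6) by move: r5 r7; clear; lia.
  have -> : 3 * L + 4 <= n by move: le Lk; clear; lia.
  by rewrite !orbT.
move=> r57; apply: admissible_k_hamiltonian => //; last by rewrite (ltnW L2).
by move=> r47; apply: h4; move: r47 r57; clear; lia.
Qed.

(** The degree condition may hold for some L below k + 1, when fewer than the
    maximal number of vertices were deleted; then the bound is strict. *)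
Lemma k_extremal (G : sgraph) (r n k L : nat) : 3 <= r -> #|G| = n -> clique_free G r.+1 ->
  chvatal_witness L (@sedge G) -> L <= k + 1 -> admissible r.-1 L n -> k + 5 < n ->
  num_edges G <= num_edges (turan r n.-1) + (k + 1) /\
  (num_edges G = num_edges (turan r n.-1) + (k + 1) <-> calG k%:Z n r G \/ calHhat k%:Z n r G).
Proof.
move=> r3 eG cf wit leL gd ltn; have r_gt0 : 0 < r by apply: leq_trans r3.
rewrite turan_num_edges //.
have n_gt0 : 0 < n by apply: leq_trans ltn.
have ek : ((k + 1)%N%:Z - 1 = k%:Z)%R by lia.
have [le eqs] := witness_extremal (ltnW r3) n_gt0 eG cf gd wit.
split; first by apply: leq_trans le _; rewrite leq_add2l.
split=> [e|[|]]; last 2 first.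
- by rewrite -ek => /calG_num_edges; rewrite turan_num_edges.
- exact: Hhat_edges.
have eL : L = k + 1 by move: le leL; rewrite e; clear; lia.
subst L; case: (eqs e) => [|[i [i2 en ex [c mc pc]]]]; first by rewrite ek; left.
by right; apply: exceptional_Hhat en ex mc pc.
Qed.

(** The graphs of calG show that the bound is tight, for every property P
    excluded by a vertex of degree L. *)
Lemma calG_extremal (P : sgraph -> Prop) (r n L : nat) : 0 < r -> 0 < n ->
  L + n.-1 %/ r <= n.-1 ->
  (forall (G : sgraph) (v : G), #|G| = n -> degree v = L -> ~ P G) ->
  (exists G, calG (L%:Z - 1)%R n r G) /\
  exists G : sgraph, [/\ #|G| = n, clique_free G r.+1, ~ P G
    & num_edges G = num_edges (turan r n.-1) + L].
Proof.
move=> r_gt0 n_gt0 le nP; have [G cG] := exists_calG r_gt0 n_gt0 le.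
split; exists G => //; have [v dv] := calG_degree cG; have [eG cf _] := cG.
by split=> //; [apply: nP eG dv|apply: calG_num_edges].
Qed.

Theorem theorem5p4 (r n : nat) (hr : 3 <= r) :
  (* (a) *)
  ((r = 3 -> 20 <= n) -> (4 <= r -> 1 <= n) ->
   [/\ forall G : sgraph, #|G| = n -> clique_free G r.+1 -> ~ traceable G ->
          num_edges G <= num_edges (turan r n.-1) /\
          (num_edges G = num_edges (turan r n.-1) <->
             calG (-1)%Z n r G
            \/ (4 <= r /\ n = 4 /\ isomorphic G (complete_multipartite [:: 3; 1]))
            \/ (r = 4 /\ n = 6 /\ isomorphic G (complete_multipartite [:: 4; 1; 1]))
            \/ (r = 4 /\ n = 8 /\ isomorphic G (complete_multipartite [:: 5; 1; 1; 1]))),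
       exists G : sgraph, calG (-1)%Z n r G
     & (1 < n -> exists G : sgraph,
         [/\ #|G| = n, clique_free G r.+1, ~ traceable G
           & num_edges G = num_edges (turan r n.-1)])]) /\
  (* (b) *)
  ((r = 3 -> 26 <= n) -> (r = 4 -> 11 <= n) -> (5 <= r -> 2 <= n) ->
   [/\ forall G : sgraph, #|G| = n -> clique_free G r.+1 -> ~ hamiltonian G ->
          num_edges G <= num_edges (turan r n.-1) + 1 /\
          (num_edges G = num_edges (turan r n.-1) + 1 <->
             calG 0%Z n r G
            \/ (5 <= r /\ n = 5 /\ isomorphic G (complete_multipartite [:: 3; 1; 1]))
            \/ (r = 4 /\ n = 11 /\ isomorphic G (complete_multipartite [:: 6; 2; 2; 1]))
            \/ (r = 5 /\ n = 7 /\ isomorphic G (complete_multipartite [:: 4; 1; 1; 1]))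
            \/ (r = 5 /\ n = 9 /\ isomorphic G (complete_multipartite [:: 5; 1; 1; 1; 1]))),
       exists G : sgraph, calG 0%Z n r G
     & exists G : sgraph,
         [/\ #|G| = n, clique_free G r.+1, ~ hamiltonian G
           & num_edges G = num_edges (turan r n.-1) + 1]]) /\
  (* (c) *)
  ((r = 3 -> 32 <= n) -> (r = 4 -> 16 <= n) -> (r = 5 -> 10 <= n) ->
   (6 <= r -> 4 <= n) ->
   [/\ forall G : sgraph, #|G| = n -> clique_free G r.+1 -> ~ ham_connected G ->
          num_edges G <= num_edges (turan r n.-1) + 2 /\
          (num_edges G = num_edges (turan r n.-1) + 2 <->
             calG 1%Z n r G
            \/ (6 <= r /\ n = 6 /\ isomorphic G (complete_multipartite [:: 3; 1; 1; 1]))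
            \/ (r = 6 /\ n = 8 /\ isomorphic G (complete_multipartite [:: 4; 1; 1; 1; 1]))
            \/ (r = 5 /\ n = 10 /\ isomorphic G (complete_multipartite [:: 5; 2; 1; 1; 1]))
            \/ (r = 6 /\ n = 10 /\ isomorphic G (complete_multipartite [:: 5; 1; 1; 1; 1; 1]))),
       exists G : sgraph, calG 1%Z n r G
     & exists G : sgraph,
         [/\ #|G| = n, clique_free G r.+1, ~ ham_connected G
           & num_edges G = num_edges (turan r n.-1) + 2]]) /\
  (* (d) *)
  (forall k : nat,
   (r = 3 -> 6 * k + 26 <= n) -> (4 <= r <= 7 -> 5 * k + 11 <= n) ->
   (8 <= r ->
      (k%:R + 5%:R + 4%:R * (k%:R + 4%:R) / (r%:R - 4%:R) <= n%:R :> rat)%R) ->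
   [/\ forall G : sgraph, #|G| = n -> clique_free G r.+1 -> ~ k_hamiltonian k G ->
          num_edges G <= num_edges (turan r n.-1) + (k + 1) /\
          (num_edges G = num_edges (turan r n.-1) + (k + 1) <->
             calG k%:Z n r G \/ calHhat k%:Z n r G),
       exists G : sgraph, calG k%:Z n r G
     & exists G : sgraph,
         [/\ #|G| = n, clique_free G r.+1, ~ k_hamiltonian k G
           & num_edges G = num_edges (turan r n.-1) + (k + 1)]]) /\
  (* (e) *)
  (forall k : nat, 1 <= k ->
   (r = 3 -> 6 * k + 26 <= n) -> (r = 4 -> 5 * k + 11 <= n) ->
   (5 <= r <= 7 -> 3 * k + 7 <= n) ->
   (8 <= r ->
      (k%:R + 5%:R + 4%:R * (k%:R + 4%:R) / (r%:R - 4%:R) <= n%:R :> rat)%R) ->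
   [/\ forall G : sgraph, #|G| = n -> clique_free G r.+1 -> ~ k_ham_connected k G ->
          num_edges G <= num_edges (turan r n.-1) + (k + 1) /\
          (num_edges G = num_edges (turan r n.-1) + (k + 1) <->
             calG k%:Z n r G \/ calHhat k%:Z n r G),
       exists G : sgraph, calG k%:Z n r G
     & exists G : sgraph,
         [/\ #|G| = n, clique_free G r.+1, ~ k_ham_connected k G
           & num_edges G = num_edges (turan r n.-1) + (k + 1)]]) /\
  (* (f) *)
  (forall k : nat, 1 <= k ->
   (r = 3 -> 6 * k + 14 <= n) -> (4 <= r <= 7 -> 5 * k + 1 <= n) ->
   (8 <= r -> 2 * k + 5 <= n) ->
   [/\ forall G : sgraph, #|G| = n -> clique_free G r.+1 -> ~ k_connected k G ->
          num_edges G <= num_edges (turan r n.-1) + (k - 1) /\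
          (num_edges G = num_edges (turan r n.-1) + (k - 1) <->
             calG (k%:Z - 2%:Z)%R n r G),
       exists G : sgraph, calG (k%:Z - 2%:Z)%R n r G
     & exists G : sgraph,
         [/\ #|G| = n, clique_free G r.+1, ~ k_connected k G
           & num_edges G = num_edges (turan r n.-1) + (k - 1)]]).
Proof.
have r_gt0 : 0 < r by apply: leq_trans hr.
have r2 : 2 <= r := ltnW hr.
split; last split; last split; last split; last split.
- move=> n3 n4; have n_gt0 : 0 < n.
    have [/n3|/n4] : r = 3 \/ 4 <= r by move: hr; clear; lia.
      by apply: leq_trans.
    by [].
  have gd : admissible r.-1 0 n.
    rewrite /admissible; have [e|e] : r = 3 \/ 4 <= r by move: hr; clear; lia.
      by rewrite {1}e (n3 e).
    by move: e; clear; lia.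
  have e0 : (0%:Z - 1)%R = (-1)%Z by [].
  have exG : exists G, calG (0%:Z - 1)%R n r G.
    by apply: exists_calG => //; apply: admissible_feasible.
  rewrite e0 in exG; split=> //; last first.
    move=> n1.
    have [|_ [G [eG cf nT eE]]] :=
    @calG_extremal traceable r n 0 r_gt0 n_gt0
      (admissible_feasible r_gt0 n_gt0 gd).
      by move=> G v eG dv; apply: not_traceable_isolated dv; rewrite eG.
    by exists G; rewrite addn0 in eE.
  move=> G eG cf nT; have wit := not_traceable_witness _ nT.
  have [|le eqs] := witness_extremal r2 n_gt0 eG cf gd (wit _); first by rewrite eG.
  rewrite turan_num_edges //; rewrite addn0 in le eqs; split=> //; split.
    move=> /eqs[|[i [i2 en ex [c mc pc]]]]; first by rewrite e0; left.
    right.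
    case/orP: ex => [/andP[/andP[/eqP ei _] lq]|].
      left; split; first by move: lq; clear; lia.
      split; first by rewrite en ei.
      by rewrite ei in pc; apply: (@triple_iso G r 0 c).
    have fin s j a := @sporadic_iso G r 0 i n c s j a r_gt0 en mc pc.
    rewrite !inE !xpair_eqE /= ?andbF ?andbT ?orbF /= => /orP[]/andP[/eqP er /eqP ei].
      by right; left; case: (fin 4 3 [:: 4; 1; 1]).
    by right; right; case: (fin 4 4 [:: 5; 1; 1; 1]).
  case=> [|[[r4 [en iso]]|[[r4 [en iso]]|[r4 [en iso]]]]].
  + by rewrite -e0 => /calG_num_edges; rewrite turan_num_edges // addn0.
  + rewrite en; apply: iso_parts_edges iso _.
    by have := @triple_edges r 0 isT; rewrite addn0; apply; apply: ltnW.
  + by rewrite r4 en; apply: iso_parts_edges iso _.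
  by rewrite r4 en; apply: iso_parts_edges iso _.
- move=> n3 n4 n5.
  have gd : admissible r.-1 1 n.
    rewrite /admissible; have [e|[e|e]] : r = 3 \/ r = 4 \/ 5 <= r by move: hr; clear; lia.
    + by rewrite {1}e (n3 e).
    + by rewrite {1 2}e (n4 e) !orbT.
    by move: e; clear; lia.
  have n_gt1 : 1 < n.
    have [/n3|[/n4|/n5]] : r = 3 \/ r = 4 \/ 5 <= r by move: hr; clear; lia.
    + by apply: leq_trans.
    + by apply: leq_trans.
    by [].
  have n_gt0 : 0 < n := ltnW n_gt1.
  have e0 : (1%:Z - 1)%R = 0%Z by [].
  have [|exG exN] :=
    @calG_extremal hamiltonian r n 1 r_gt0 n_gt0
      (admissible_feasible r_gt0 n_gt1 gd).
    by move=> G v eG dv /(hamiltonian_degree v); rewrite dv.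
  rewrite e0 in exG; split=> // G eG cf nH.
  have wit : chvatal_witness 1 (@sedge G).
    have [n2|n2] := leqP n 2; last by apply: not_hamiltonian_witness; rewrite ?eG.
    have /card_gt0P[v _] : 0 < #|G| by rewrite eG.
    left; exists v; rewrite -ltnS -[rel_degree _ v]/(degree v) -degree_inT.
    by apply: leq_trans (degree_in_lt (in_setT v)) _; rewrite cardsT eG.
  have [le eqs] := witness_extremal r2 n_gt0 eG cf gd wit.
  rewrite turan_num_edges //; split=> //; split.
    move=> /eqs[|[i [i2 en ex [c mc pc]]]]; first by rewrite e0; left.
    right.
    case/orP: ex => [/andP[/andP[/eqP ei _] lq]|].
      left; split; first by move: lq; clear; lia.
      split; first by rewrite en ei.
      by rewrite ei in pc; apply: (@triple_iso G r 1 c).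
    have fin s j a := @sporadic_iso G r 1 i n c s j a r_gt0 en mc pc.
    rewrite !inE !xpair_eqE /= ?andbF ?andbT ?orbF /= => /or3P[]/andP[/eqP er /eqP ei].
    + by right; right; left; case: (fin 5 3 [:: 4; 1; 1; 1]).
    + by right; right; right; case: (fin 5 4 [:: 5; 1; 1; 1; 1]).
    by right; left; case: (fin 4 5 [:: 6; 2; 2; 1]).
  case=> [|[[r4 [en iso]]|[[r4 [en iso]]|[[r4 [en iso]]|[r4 [en iso]]]]]].
  + by rewrite -e0 => /calG_num_edges; rewrite turan_num_edges.
  + rewrite en; apply: iso_parts_edges iso _.
    by have := @triple_edges r 1 isT; apply; apply: ltnW.
  + by rewrite r4 en; apply: iso_parts_edges iso _.
  + by rewrite r4 en; apply: iso_parts_edges iso _.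
  by rewrite r4 en; apply: iso_parts_edges iso _.
- move=> n3 n4 n5 n6.
  have gd : admissible r.-1 2 n.
    rewrite /admissible; have [e|[e|[e|e]]] : r = 3 \/ r = 4 \/ r = 5 \/ 6 <= r
      by move: hr; clear; lia.
    + by rewrite {1}e (n3 e).
    + by rewrite {1 2}e (n4 e) !orbT.
    + by rewrite e (n5 e).
    by move: e; clear; lia.
  have n_gt3 : 3 < n.
    have [/n3|[/n4|[/n5|/n6]]] : r = 3 \/ r = 4 \/ r = 5 \/ 6 <= r by move: hr; clear; lia.
    + by apply: leq_trans.
    + by apply: leq_trans.
    + by apply: leq_trans.
    by [].
  have n_gt0 : 0 < n by apply: leq_trans n_gt3.
  have e0 : (2%:Z - 1)%R = 1%Z by [].
  have [|exG exN] :=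
    @calG_extremal ham_connected r n 2 r_gt0 n_gt0
      (admissible_feasible r_gt0 (ltnW n_gt3) gd).
    by move=> G v eG dv hc; apply: (ham_connected_degree (v := v) hc); rewrite ?eG.
  rewrite e0 in exG; split=> // G eG cf nH.
  have wit := not_ham_connected_witness nH.
  have [le eqs] := witness_extremal r2 n_gt0 eG cf gd wit.
  rewrite turan_num_edges //; split=> //; split.
    move=> /eqs[|[i [i2 en ex [c mc pc]]]]; first by rewrite e0; left.
    right.
    case/orP: ex => [/andP[/andP[/eqP ei _] lq]|].
      left; split; first by move: lq; clear; lia.
      split; first by rewrite en ei.
      by rewrite ei in pc; apply: (@triple_iso G r 2 c).
    have fin s j a := @sporadic_iso G r 2 i n c s j a r_gt0 en mc pc.
    rewrite !inE !xpair_eqE /= ?andbF ?andbT ?orbF /= => /or3P[]/andP[/eqP er /eqP ei].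
    + by right; left; case: (fin 6 3 [:: 4; 1; 1; 1; 1]).
    + by right; right; right; case: (fin 6 4 [:: 5; 1; 1; 1; 1; 1]).
    by right; right; left; case: (fin 5 4 [:: 5; 2; 1; 1; 1]).
  case=> [|[[r4 [en iso]]|[[r4 [en iso]]|[[r4 [en iso]]|[r4 [en iso]]]]]].
  + by rewrite -e0 => /calG_num_edges; rewrite turan_num_edges.
  + rewrite en; apply: iso_parts_edges iso _.
    by have := @triple_edges r 2 isT; apply; apply: ltnW.
  + by rewrite r4 en; apply: iso_parts_edges iso _.
  + by rewrite r4 en; apply: iso_parts_edges iso _.
  by rewrite r4 en; apply: iso_parts_edges iso _.
- move=> k n3 n4 n8.
  have h8 : 8 <= r -> (k + 5) * (r - 4) + 4 * (k + 4) <= n * (r - 4).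
    by move=> r8; apply: rat_threshold (n8 r8).
  have gd L : 1 <= L <= k + 1 -> admissible r.-1 L n /\ k + 5 < n
    by apply: admissible_k_hamiltonian.
  have [|gdk ltn] := gd (k + 1); first by rewrite addn1 leqnn.
  have n_gt0 : 0 < n by apply: leq_trans ltn.
  have lt1 : k + 1 < n by move: ltn; clear; lia.
  have ek : ((k + 1)%N%:Z - 1 = k%:Z)%R by lia.
  have [|exG exN] :=
    @calG_extremal (k_hamiltonian k) r n (k + 1) r_gt0 n_gt0
      (admissible_feasible r_gt0 lt1 gdk).
    by move=> G v eG dv; apply: not_k_hamiltonian dv.
  rewrite ek in exG; split=> // G eG cf nH.
  have [S leS nS] : exists2 S : {set G}, #|S| <= k & ~ hamiltonian (del_vertices S).
    by apply: NNPP => h; apply: nH => S leS; apply: NNPP => h'; apply: h; exists S.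
  have cS : 2 < #|del_vertices S|.
    by rewrite card_sub_set -(ltn_add2l #|S|) cardsC eG; move: leS ltn; clear; lia.
  have wit := witness_del (not_hamiltonian_witness cS nS).
  have leL : 1 + #|S| <= k + 1 by rewrite addnC leq_add2r.
  have [//|gdL _] := gd (1 + #|S|).
  exact: k_extremal wit leL gdL ltn.
- move=> k k0 n3 n4 n5 n8.
  have h8 : 8 <= r -> (k + 5) * (r - 4) + 4 * (k + 4) <= n * (r - 4).
    by move=> r8; apply: rat_threshold (n8 r8).
  have gd L : 2 <= L <= k + 1 -> admissible r.-1 L n /\ k + 5 < n
    by apply: admissible_k_ham_connected.
  have [|gdk ltn] := gd (k + 1); first by rewrite addn1 leqnn ltnS k0.
  have n_gt0 : 0 < n by apply: leq_trans ltn.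
  have lt1 : k + 1 < n by move: ltn; clear; lia.
  have ek : ((k + 1)%N%:Z - 1 = k%:Z)%R by lia.
  have [|exG exN] :=
    @calG_extremal (k_ham_connected k) r n (k + 1) r_gt0 n_gt0
      (admissible_feasible r_gt0 lt1 gdk).
    move=> G v eG dv; apply: not_k_ham_connected dv => //.
    by rewrite eG; move: ltn; clear; lia.
  rewrite ek in exG; split=> // G eG cf nH.
  have [S leS nS] : exists2 S : {set G}, #|S| < k & ~ ham_connected (del_vertices S).
    by apply: NNPP => h; apply: nH => S leS; apply: NNPP => h'; apply: h; exists S.
  have wit := witness_del (not_ham_connected_witness nS).
  have leL : 2 + #|S| <= k + 1 by rewrite addn1 !addSn !ltnS add0n.
  have [//|gdL _] := gd (2 + #|S|).
  exact: k_extremal wit leL gdL ltn.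
move=> k k0 n3 n4 n8.
have gd : admissible_connectivity r (k - 1) n.
  apply/or3P; have [e|[e|e]] : r = 3 \/ 4 <= r <= 7 \/ 8 <= r by move: hr; clear; lia.
  - by constructor 1; rewrite {1}e eqxx /=; move: (n3 e) k0; clear; lia.
  - by constructor 2; rewrite e /=; move: (n4 e) k0; clear; lia.
  by constructor 3; rewrite e /=; move: (n8 e) k0; clear; lia.
have n_gt0 : 0 < n.
  have [/n3|[/n4|/n8]] : r = 3 \/ 4 <= r <= 7 \/ 8 <= r by move: hr; clear; lia.
  - by clear; lia.
  - by clear; lia.
  by clear; lia.
have ek : ((k - 1)%N%:Z - 1 = k%:Z - 2%:Z)%R by move: k0; clear; lia.
have [|exG exN] :=
    @calG_extremal (k_connected k) r n (k - 1) r_gt0 n_gt0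
      (admissible_connectivity_feasible gd).
  move=> G v eG dv; apply: not_k_connected dv => //; rewrite eG.
  have [/n3|[/n4|/n8]] : r = 3 \/ 4 <= r <= 7 \/ 8 <= r by move: hr; clear; lia.
  - by clear; lia.
  - by move: k0; clear; lia.
  by clear; lia.
rewrite ek in exG; split=> // G eG cf nC.
have [S leS nS] : exists2 S : {set G}, #|S| < k & ~ connected (del_vertices S).
  by apply: NNPP => h; apply: nC => S leS; apply: NNPP => h'; apply: h; exists S.
have leS' : #|S| <= k - 1 by move: leS; clear; lia.
have [le eqs] := disconnected_extremal r2 eG cf gd leS' nS.
rewrite -ek turan_num_edges //; split=> //; split=> // /calG_num_edges.
by rewrite turan_num_edges.
Qed.
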